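(* Let $u$ be a minimizer of the functional $J$ over the admissible class $\mathcal A$. Then $\Delta u\in BMO_{\rm loc}(\Omega)$.
   Context: $\Omega\subset\mathbb R^n$ is a smooth bounded domain and $u_0\in W^{2,2}(\Omega)$ is given. The functional is $J[u]=J[u,\Omega]:=\int_\Omega\big(|\Delta u|^2+\chi_{\{u>0\}}\big)$ and the admissible class is $\mathcal A:=\{u\in W^{2,2}(\Omega)\ :\ u-u_0\in W^{1,2}_0(\Omega)\}$. A minimizer of $J$ is a function $u\in\mathcal A$ with $J[u]\le J[v]$ for all $v\in\mathcal A$. $BMO_{\rm loc}(\Omega)$ denotes the space of functions of locally bounded mean oscillation. *)

(* Defs.v *)
From HB Require Import structures.
From mathcomp Require Import all_boot all_order all_algebra.
From mathcomp Require Import all_classical all_reals all_analysis.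

Set Implicit Arguments.
Unset Strict Implicit.
Unset Printing Implicit Defensive.

Import Order.TTheory GRing.Theory Num.Theory.
Import numFieldNormedType.Exports.

Local Open Scope classical_set_scope.
Local Open Scope ring_scope.

Definition measure_rV_display : measure_display.
Proof. exact: default_measure_display. Qed.

(* As for the library's [n.-tuple T], the sigma-algebra of R^n is generated by
   the coordinates; it is the Borel sigma-algebra. *)
Section measurable_rV.
Context {R : realType} (n : nat).

Let coor (i : 'I_n) (x : 'rV[R]_n) : R := x ord0 i.

Let rV_set0 : g_sigma_preimage coor set0.
Proof. exact: sigma_algebra0. Qed.

Let rV_setC A : g_sigma_preimage coor A -> g_sigma_preimage coor (~` A).
Proof. exact: sigma_algebraC. Qed.

Let rV_bigcup (F : (set 'rV[R]_n)^nat) :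
  (forall i, g_sigma_preimage coor (F i)) ->
  g_sigma_preimage coor (\bigcup_i (F i)).
Proof. exact: sigma_algebra_bigcup. Qed.

HB.instance Definition _ := @isMeasurable.Build measure_rV_display
  'rV[R]_n (g_sigma_preimage coor) rV_set0 rV_setC rV_bigcup.

End measurable_rV.

Lemma measurable_coor (R : realType) n (i : 'I_n) :
  measurable_fun [set: 'rV[R]_n] (fun x : 'rV[R]_n => x ord0 i).
Proof.
move=> _ Y mY; rewrite setTI; apply: sub_sigma_algebra => /=.
rewrite -bigcup_seq/=; exists i => /=; first by rewrite mem_index_enum.
by exists Y => //; rewrite setTI.
Qed.

Lemma measurable_fun_rVP d (T : measurableType d) (R : realType) n
    (f : T -> 'rV[R]_n) :
  (forall i, measurable_fun [set: T] (fun t => f t ord0 i)) ->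
  measurable_fun [set: T] f.
Proof.
move=> mf _ A mA; rewrite setTI.
suff : g_sigma_preimage (fun (i : 'I_n) (x : 'rV[R]_n) => x ord0 i) `<=`
    [set B | measurable (f @^-1` B)] by apply.
apply: smallest_sub.
  split => /=.
  - by rewrite preimage_set0; exact: measurable0.
  - by move=> B mB; rewrite setTD preimage_setC; exact: measurableC.
  - by move=> F mF; rewrite preimage_bigcup; exact: bigcupT_measurable.
rewrite -bigcup_seq => B [i _ [C mC <-]] /=; rewrite setTI -comp_preimage.
by rewrite -[X in measurable X]setTI; exact: mf.
Qed.

Section lebesgue_measure_rV.
Context {R : realType}.

Definition rV_cons n (p : measurableTypeR R * 'rV[R]_n) : 'rV[R]_n.+1 :=
  row_mx (const_mx p.1 : 'rV_1) p.2.

Definition rV_behead n (x : 'rV[R]_n.+1) : 'rV[R]_n :=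
  \row_i x ord0 (lift ord0 i).

Lemma rV_consE0 n (p : measurableTypeR R * 'rV[R]_n) : rV_cons p ord0 ord0 = p.1.
Proof.
have -> : ord0 = lshift n (ord0 : 'I_1) :> 'I_(1 + n) by exact/val_inj.
by rewrite (@row_mxEl _ 1 1 n) mxE.
Qed.

Lemma rV_consES n (p : measurableTypeR R * 'rV[R]_n) i :
  rV_cons p ord0 (lift ord0 i) = p.2 ord0 i.
Proof.
have -> : lift ord0 i = rshift 1 i :> 'I_(1 + n) by exact/val_inj.
by rewrite (@row_mxEr _ 1 1 n).
Qed.

Lemma rV_consK n (p : measurableTypeR R * 'rV[R]_n) : rV_behead (rV_cons p) = p.2.
Proof. by apply/rowP => i; rewrite mxE rV_consES. Qed.

Lemma measurable_rV_cons n : measurable_fun setT (@rV_cons n).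
Proof.
apply: measurable_fun_rVP => i; have [j ->|->] := unliftP ord0 i.
  under eq_fun do rewrite rV_consES.
  by apply: (measurableT_comp (measurable_coor j)); exact: measurable_snd.
under eq_fun do rewrite rV_consE0.
exact: measurable_fst.
Qed.

Lemma measurable_rV_behead n : measurable_fun setT (@rV_behead n).
Proof.
apply: measurable_fun_rVP => i; under eq_fun do rewrite mxE.
exact: measurable_coor.
Qed.

Section step.
Context (n : nat) (l : {sigma_finite_measure set (measurableTypeR R) -> \bar R})
  (m : {sigma_finite_measure set 'rV[R]_n -> \bar R}).

Definition product_rV : set 'rV[R]_n.+1 -> \bar R :=
  pushforward (l \x m)%E (@rV_cons n).

Let product_rV0 : product_rV set0 = 0%E.
Proof. by rewrite /product_rV /pushforward preimage_set0 measure0. Qed.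

Let mpreimage A : measurable A -> measurable (@rV_cons n @^-1` A).
Proof.
by move=> mA; rewrite -[X in measurable X]setTI; exact: measurable_rV_cons.
Qed.

Let product_rV_ge0 A : (0 <= product_rV A)%E.
Proof. exact: (measure_ge0 (l \x m)%E). Qed.

Let product_rV_sigma_additive : semi_sigma_additive product_rV.
Proof.
move=> F mF tF mUF; rewrite /product_rV /pushforward preimage_bigcup.
apply: measure_semi_sigma_additive.
- by move=> k; exact: mpreimage.
- apply/trivIsetP => /= i j _ _ ij; rewrite -preimage_setI.
  by move/trivIsetP : tF => /(_ _ _ _ _ ij) ->//; rewrite preimage_set0.
- by rewrite -preimage_bigcup; exact: mpreimage.
Qed.

HB.instance Definition _ := isMeasure.Build _ _ _ product_rV
  product_rV0 product_rV_ge0 product_rV_sigma_additive.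

Let sigma_finite_product_rV : sigma_finite setT product_rV.
Proof.
have /sigma_finiteP[F [TF ndF Foo]] := sigma_finiteT l.
have /sigma_finiteP[G [TG ndG Goo]] := sigma_finiteT m.
pose box k := [set x : 'rV[R]_n.+1 | F k (x ord0 ord0) /\ G k (rV_behead x)].
have boxE k : @rV_cons n @^-1` box k = F k `*` G k.
  apply/seteqP; split=> -[x v] /=; rewrite /box /= rV_consE0 rV_consK//.
exists box.
  rewrite predeqE => x; split => // _.
  have [i _ Fi] : (\bigcup_k F k) (x ord0 ord0) by rewrite -TF.
  have [j _ Gj] : (\bigcup_k G k) (rV_behead x) by rewrite -TG.
  exists (maxn i j) => //; split.
    by move: Fi; exact/subsetPset/ndF/leq_maxl.
  by move: Gj; exact/subsetPset/ndG/leq_maxr.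
move=> k; have [mFk ?] := Foo k; have [mGk ?] := Goo k; split.
  apply: measurableI.
    by rewrite -[X in measurable X]setTI; exact: measurable_coor.
  by rewrite -[X in measurable X]setTI; exact: measurable_rV_behead.
rewrite /product_rV /pushforward boxE product_measure1E//.
by rewrite lte_mul_pinfty// ge0_fin_numE.
Qed.

HB.instance Definition _ := Measure_isSigmaFinite.Build _ _ _
  product_rV sigma_finite_product_rV.

End step.

(* The product measure on R^n, as an iterated product R * R^(n-1); R^0 is a
   point, of measure 1. *)
Fixpoint lebesgue_rV n : {sigma_finite_measure set 'rV[R]_n -> \bar R} :=
  match n return {sigma_finite_measure set 'rV[R]_n -> \bar R} with
  | 0 => [the {sigma_finite_measure set 'rV[R]_0 -> \bar R} of
           @dirac _ 'rV[R]_0 0 R]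
  | n'.+1 => [the {sigma_finite_measure set 'rV[R]_n'.+1 -> \bar R} of
      product_rV
        [the {sigma_finite_measure set (measurableTypeR R) -> \bar R} of
          @lebesgue_measure R]
        (lebesgue_rV n')]
  end.

End lebesgue_measure_rV.
Arguments lebesgue_rV {R} n.

Section smooth.
Context {R : realType} {n : nat}.
Implicit Types (f : 'rV[R]_n -> R) (s : seq 'I_n) (Omega : set 'rV[R]_n).

(* D^alpha f, the multi-index alpha being the list [s] of the successive
   directions of differentiation. *)
Definition partials s f : 'rV[R]_n -> R :=
  foldr (fun i g x => 'D_(delta_mx ord0 i) g x) f s.

Definition smooth f := forall s, continuous (partials s f) /\
  forall i x, derivable (partials s f) x (delta_mx ord0 i).

Definition test_function Omega f :=
  smooth f /\ exists K, [/\ compact K, K `<=` Omega &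
    forall x, ~ K x -> f x = 0].

End smooth.

(* Near each boundary point, up to a relabelling of the coordinates and a
   reflection, Omega is the strict epigraph of a smooth function of the
   remaining n - 1 variables. *)
Definition smooth_boundary (R : realType) n (Omega : set 'rV[R]_n) :=
  forall x0, (closure Omega `\` interior Omega) x0 ->
  exists i : 'I_n, exists b : bool, exists gamma : 'rV[R]_n.-1 -> R,
    smooth gamma /\
    \forall x \near x0,
      Omega x <-> 0 < (-1) ^+ b * (x ord0 i - gamma (col' i x)).

Definition smooth_bounded_domain (R : realType) n (Omega : set 'rV[R]_n) :=
  [/\ Omega !=set0, open Omega, connected Omega, bounded_set Omega &
      smooth_boundary Omega].

Section sobolev.
Context {R : realType} {n : nat} (Omega : set 'rV[R]_n).
Implicit Types (u v w f : 'rV[R]_n -> R) (s : seq 'I_n).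
Local Notation mu := (@lebesgue_rV R n).

Definition L1loc f := measurable_fun Omega f /\
  forall K, compact K -> K `<=` Omega -> mu.-integrable K (EFin \o f).

Definition L2 f := measurable_fun Omega f /\
  (\int[mu]_(x in Omega) (`|f x| ^+ 2)%:E < +oo)%E.

Definition weak_derivative s u v := [/\ L1loc u, L1loc v &
  forall phi, test_function Omega phi ->
    \int[mu]_(x in Omega) (u x * partials s phi x) =
    (-1) ^+ size s * \int[mu]_(x in Omega) (v x * phi x)].

Definition sobolevW2 (k : nat) u := L1loc u /\
  forall s, (size s <= k)%N -> exists2 v, weak_derivative s u v & L2 v.

(* A representative of the weak derivative D^s u (unique up to a null set),
   when it exists. *)
Definition wderiv s u : 'rV[R]_n -> R := get (weak_derivative s u).

Definition laplacian u : 'rV[R]_n -> R :=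
  fun x => \sum_(i < n) wderiv [:: i; i] u x.

Definition norm_W12 w : \bar R :=
  ((\int[mu]_(x in Omega)
      (`|w x| ^+ 2 + \sum_(i < n) `|wderiv [:: i] w x| ^+ 2)%:E) `^ 2^-1)%E.

Definition sobolevW12_0 w := sobolevW2 1 w /\
  forall e : R, 0 < e -> exists2 phi, test_function Omega phi &
    (norm_W12 (w \- phi)%R < e%:E)%E.

Definition J u : \bar R :=
  (\int[mu]_(x in Omega)
     (`|laplacian u x| ^+ 2 + \1_[set y | 0 < u y] x)%:E)%E.

Definition admissible u0 u := sobolevW2 2 u /\ sobolevW12_0 (u \- u0).

Definition minimizer u0 u := admissible u0 u /\
  forall v, admissible u0 v -> (J u <= J v)%E.

End sobolev.

Section bmo.
Context {R : realType} {n : nat}.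
Implicit Types (D Omega : set 'rV[R]_n) (f : 'rV[R]_n -> R).
Local Notation mu := (@lebesgue_rV R n).

(* The library's [ball] on ['rV_n] is the one of the sup norm. *)
Definition eball (x : 'rV[R]_n) (r : R) : set 'rV[R]_n :=
  [set y | Num.sqrt (\sum_(i < n) (y ord0 i - x ord0 i) ^+ 2) < r].

Definition average f (B : set 'rV[R]_n) : R :=
  (fine (mu B))^-1 * \int[mu]_(y in B) f y.

Definition BMO D f := L1loc D f /\
  exists C : R, forall x r, 0 < r -> eball x r `<=` D ->
    (\int[mu]_(y in eball x r) `|f y - average f (eball x r)|%:E
       <= C%:E * mu (eball x r))%E.

Definition BMO_loc Omega f :=
  L1loc Omega f /\
  forall D, open D -> compact (closure D) -> closure D `<=` Omega -> BMO D f.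

End bmo.

(* Main.v *)
(** Let g be the Laplacian of the minimizer u. Comparing u with u + t phi, where phi is
    supported in a ball U, gives |int g Lap(phi)| <= |U| sup |Lap(phi)|. For a suitable
    radial mollifier eta_r, the derivative of eta_r in r is the Laplacian of a function
    supported in the ball of radius r, so eta_r - eta_s is a uniform limit of such
    Laplacians. Two consequences follow. First, telescoping over dyadic scales, the
    mollification of g at scale r oscillates by O(1) on balls of radius r, because a
    difference of two translates of eta_s by a vector of length r has sup norm
    O(s^(-n) r / s). Secondly, for 0 <= psi <= 1 supported in a ball of radius r, psi is
    the limit of its mollifications psi * eta_e, and psi * eta_e - psi * eta_r has sup norm
    O(1), so int g psi differs from int g (psi * eta_r) by O(r^n). Together these bound
    int (g - c) psi by O(r^n), where c is the mollification of g at the center, and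
    letting psi tend to indicator functions yields the bound on the mean oscillation. *)

Require Import Defs.
From mathcomp Require Import all_boot all_order all_algebra.
From mathcomp Require Import all_classical all_reals all_analysis.
From mathcomp Require Import measurable_realfun ring lra.

Set Implicit Arguments.
Unset Strict Implicit.
Unset Printing Implicit Defensive.

Import Order.TTheory GRing.Theory Num.Theory.
Import numFieldNormedType.Exports.

Local Open Scope classical_set_scope.
Local Open Scope ring_scope.

(** * Borel sets and affine changes of variables in R^n *)

(** The indicator term is not differentiable, so minimality yields no equation for g. What survives
    is that a perturbation supported in U changes this term by at most |U|; on a ball of radius r
    this is O(r^n), exactly the order that bounded mean oscillation allows.

    The mollifier comes from a potential. Put z = x - y, l = 1/r, b(t) = exp(-1/t) for t > 0 and 0
    otherwise, P = b(1 - l^2 |z|^2) and K = l^n b'(1 - l^2 |z|^2). Euler's identity for the scaling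
    gives dK/dl = l^(-1) div(z K), while grad P = -2 l^2 z b'(1 - l^2 |z|^2) means z K = -(l^n / (2
    l^2)) grad P. Hence dK/dl is the Laplacian of -(l^n / (2 l^3)) P, which has compact support.
    Since b'(t) = t^(-2) b(t), the potential is built on [bump 0] and the kernel on [bump 2]. *)

Section measurable_topology.
Context {R : realType} {n : nat}.
Implicit Types (x y : 'rV[R]_n) (A : set 'rV[R]_n).

Lemma rV_ballP x y (r : R) :
  ball x r y <-> 0 < r /\ forall i, `|x ord0 i - y ord0 i| < r.
Proof.
split => [[r0 h]|[r0 h]]; first by split => // i; exact: h.
by split => // i j; rewrite (ord1 i); exact: h.
Qed.

Lemma measurable_ball_rV x (r : R) : measurable (ball x r).
Proof.
have [r0|r0] := ltP 0 r; last first.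
  suff -> : ball x r = set0 by [].
  by rewrite -subset0 => y /rV_ballP[]; rewrite ltNge r0.
have -> : ball x r = \bigcap_(i in [set: 'I_n])
    ((fun y : 'rV[R]_n => y ord0 i) @^-1` ball (x ord0 i) r).
  apply/seteqP; split=> y; first by move=> /rV_ballP[_ h] i _; exact: h.
  by move=> h; apply/rV_ballP; split => // i; exact: h.
apply: fin_bigcap_measurable => // i _.
rewrite -[X in measurable X]setTI; apply: measurable_coor => //.
exact: measurable_ball.
Qed.

(** The index set is countable, which serves both for the measurability of open sets and for
    localizing almost-everywhere statements. The doubled ball leaves room for a compact ball inside
    A, as [fundamental_lemma] requires. *)
Lemma open_bigcup_ball_rV A : open A ->
  A = \bigcup_(q in [set q : 'rV[rat]_n * nat |
        ball (map_mx ratr q.1 : 'rV[R]_n) (2 * q.2.+1%:R^-1) `<=` A])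
      ball (map_mx ratr q.1 : 'rV[R]_n) (q.2.+1%:R^-1).
Proof.
move=> oA; apply/seteqP; split=> [x Ax|x [q qA]]; last first.
  move=> /rV_ballP[q0 xq]; apply: qA; apply/rV_ballP; split=> [|i].
    by rewrite mulr_gt0.
  by apply: lt_le_trans (xq i) _; rewrite ler_peMl ?ler1n// ltW.
have /nbhs_ballP[e /= e0 eA] : nbhs x A by exact: open_nbhs_nbhs.
(* A ball of radius 2 d whose center is within d of x lies in the ball of radius 3 d around x, hence
   the 3. *)
pose k := Num.truncn (3 / e).
have ke : 3 * k.+1%:R^-1 < e.
  rewrite ltr_pdivrMr// -ltr_pdivrMl// mulrC; exact: truncnS_gt.
have k0 : 0 < k.+1%:R^-1 :> R by rewrite invr_gt0.
move dE : (k.+1%:R^-1 : R) ke k0 => d de d0.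
have /choice[q qP] : forall i : 'I_n, exists q : rat,
    `|x ord0 i - ratr q| < d.
  move=> i; have [|q] := @rat_in_itvoo _ (x ord0 i - d) (x ord0 i + d); first lra.
  rewrite in_itv/= => /andP[q1 q2]; exists q.
  by rewrite ltr_norml; apply/andP; split; lra.
exists (\row_i q i, k); rewrite /= dE.
  move=> y /rV_ballP[_ h]; apply: eA; apply/rV_ballP; split => // i.
  have := h i; have := qP i; rewrite !mxE/= => h1 h2.
  rewrite (le_lt_trans (ler_distD (ratr (q i)) _ _))//.
  by apply: lt_trans de; lra.
by apply/rV_ballP; split => // i; rewrite !mxE distrC.
Qed.

Lemma open_measurable_rV A : open A -> measurable A.
Proof.
move=> /open_bigcup_ball_rV ->; rewrite bigcup_mkcond.
apply: countable_bigcupT_measurable => // q.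
by case: ifP => // _; exact: measurable_ball_rV.
Qed.

Lemma closed_measurable_rV A : closed A -> measurable A.
Proof.
by move=> cA; rewrite -[A]setCK; apply: measurableC;
  apply: open_measurable_rV; exact: closed_openC.
Qed.

Lemma compact_measurable_rV A : compact A -> measurable A.
Proof.
move=> cA; apply: closed_measurable_rV; apply: compact_closed => //.
Qed.

Lemma continuous_measurable_rV (f : 'rV[R]_n -> R) :
  continuous f -> measurable_fun setT f.
Proof.
move=> cf; apply: (measurability _ (RGenOpens.measurableE R)).
move=> _ [_ [a [b ->]] <-]; rewrite setTI; apply: open_measurable_rV.
by apply: open_comp; [move=> x _; exact: cf|exact: itv_open].
Qed.

End measurable_topology.

Section affine.
Context {R : realType}.

Definition aff n (l : R) (a x : 'rV[R]_n) : 'rV[R]_n := l *: x + a.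

Lemma measurable_aff n l a : measurable_fun setT (@aff n l a).
Proof.
apply: measurable_fun_rVP => i; under eq_fun do rewrite !mxE.
by apply: measurable_funD => //; apply: measurable_funM => //; exact: measurable_coor.
Qed.

Lemma measurable_aff1 (l a : R) :
  measurable_fun setT (fun t : measurableTypeR R => l * t + a : measurableTypeR R).
Proof. by apply: measurable_funD => //; exact: measurable_funM. Qed.

(** The scaled pushforward is a measure with the right values on half-open intervals, and these
    determine Lebesgue measure. *)
Lemma lebesgue_measure_aff (l a : R) (A : set (measurableTypeR R)) : 0 < l ->
  measurable A ->
  (l%:E * lebesgue_measure ((fun t : R => (l * t + a)%R) @^-1` A) =
   lebesgue_measure A)%E.
Proof.
move=> l0 mA.
pose f t : measurableTypeR R := l * t + a.
pose m := mscale (NngNum (ltW l0))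
  (measure_function_pushforward__canonical__measure_function_Measure
     (@lebesgue_measure R) (measurable_aff1 l a)).
rewrite -[LHS]/(m A); apply/esym/lebesgue_measure_unique => // X [[b c] /= bc <-].
rewrite /m /mscale/= /pushforward/=.
have -> : f @^-1` `]b, c]%classic = `](b - a) / l, (c - a) / l]%classic.
  apply/seteqP; split => t /=; rewrite /f !in_itv/= ltr_pdivrMr// ler_pdivlMr//;
  move=> /andP[? ?]; apply/andP; split; lra.
rewrite !lebesgue_measure_itv/= !lte_fin ltr_pM2r ?invr_gt0// ltrBlDr subrK.
case: ifPn => // _; last by rewrite mule0.
rewrite -!EFinD -EFinM; congr EFin; field; exact: lt0r_neq0.
Qed.

(** Induction on the dimension: the scaled pushforward agrees with the product measure on
    rectangles, which suffices by uniqueness of the product. *)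
Lemma lebesgue_rV_aff n (l : R) (a : 'rV[R]_n) (A : set 'rV[R]_n) : 0 < l ->
  measurable A ->
  ((l ^+ n)%:E * lebesgue_rV n (aff l a @^-1` A) = lebesgue_rV n A)%E.
Proof.
move=> l0; elim: n a A => [|n IH] a A mA.
  rewrite expr0 mul1e/= /dirac !indicE; congr (_%:R%:E).
  congr nat_of_bool; apply/idP/idP; rewrite !inE /preimage/=;
    by rewrite [aff _ _ _](_ : _ = 0)//; apply/rowP => -[].
rewrite /= /product_rV /pushforward.
have msplit : measurable_fun setT (fun p : measurableTypeR R * 'rV[R]_n =>
    (l * p.1 + a ord0 ord0 : measurableTypeR R, aff l (rV_behead a) p.2)).
  apply: measurable_fun_pair.
    exact: (measurableT_comp (measurable_aff1 _ _) measurable_fst).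
  exact: (measurableT_comp (measurable_aff _ _) measurable_snd).
set f := (X in measurable_fun setT X) in msplit.
have -> : @rV_cons R n @^-1` (aff l a @^-1` A) = f @^-1` (@rV_cons R n @^-1` A).
  rewrite -[LHS]/((aff l a \o @rV_cons R n) @^-1` A).
  rewrite -[RHS]/((@rV_cons R n \o f) @^-1` A).
  congr (_ @^-1` A); apply/funext => -[t v].
  have affE m (w : 'rV[R]_m) b k : aff l b w ord0 k = l * w ord0 k + b ord0 k.
    by rewrite !mxE.
  apply/rowP => i; rewrite [LHS]affE /f /=; have [j ->|->] := unliftP ord0 i.
    by rewrite !rV_consES affE mxE.
  by rewrite !rV_consE0.
have ln0 : 0 <= l ^+ n.+1 by rewrite exprn_ge0// ltW.
pose m := mscale (NngNum ln0) (measure_function_pushforward__canonical__measure_function_Measure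
  (@lebesgue_measure R \x lebesgue_rV n)%E msplit).
rewrite -[LHS]/(m _).
apply/esym/product_measure_unique.
  move=> X Y mX mY; rewrite /m /mscale/= /pushforward.
  change ((l ^+ n.+1)%:E * (lebesgue_measure \x lebesgue_rV n)
    (((fun t : R => (l * t + a ord0 ord0)%R) @^-1` X) `*`
     (aff l (rV_behead a) @^-1` Y)) = lebesgue_measure X * lebesgue_rV n Y)%E.
  rewrite product_measure1E//; last 2 first.
    rewrite -[X in measurable X]setTI; exact: measurable_aff1.
    rewrite -[X in measurable X]setTI; exact: measurable_aff.
  rewrite -(lebesgue_measure_aff (a ord0 ord0) l0 mX) -(IH (rV_behead a) Y mY).
  by rewrite exprS EFinM muleACA.
rewrite -[X in measurable X]setTI; exact: measurable_rV_cons.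
Qed.

Lemma lebesgue_rV_ball n (x : 'rV[R]_n) (r : R) : 0 < r ->
  lebesgue_rV n (ball x r) = ((2 * r) ^+ n)%:E.
Proof.
move=> r0; elim: n x => [|n IH] x.
  by rewrite expr0/= /dirac indicE mem_set//; apply/rV_ballP; split => // -[].
rewrite /= /product_rV /pushforward.
have -> : @rV_cons R n @^-1` (ball x r) =
    (ball (x ord0 ord0) r : set (measurableTypeR R)) `*` ball (rV_behead x) r.
  apply/seteqP; split => -[t v] /=.
    move=> /rV_ballP[_ h]; split.
      by have := h ord0; rewrite rV_consE0.
    by apply/rV_ballP; split => // i; have := h (lift ord0 i); rewrite rV_consES mxE.
  move=> [h1 /rV_ballP[_ h2]]; apply/rV_ballP; split => // i.
  have [j ->|->] := unliftP ord0 i; last by rewrite rV_consE0.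
  by have := h2 j; rewrite mxE rV_consES.
rewrite product_measure1E//; [|exact: measurable_ball|exact: measurable_ball_rV].
rewrite IH [X in (X * _)%E](lebesgue_measure_ball _ (ltW r0)).
by rewrite -EFinM exprS mulr_natl.
Qed.

Lemma integral_lebesgue_rV_aff n (l : R) (a : 'rV[R]_n) (f : 'rV[R]_n -> \bar R) :
  0 < l -> measurable_fun setT f -> (forall x, 0 <= f x)%E ->
  ((l ^+ n)%:E * \int[lebesgue_rV n]_x f (aff l a x) = \int[lebesgue_rV n]_x f x)%E.
Proof.
move=> l0 mf f0.
have ln0 : 0 <= l ^+ n by rewrite exprn_ge0// ltW.
pose m := mscale (NngNum ln0) (measure_function_pushforward__canonical__measure_function_Measure
  (lebesgue_rV n) (measurable_aff l a)).
rewrite [RHS](eq_measure_integral m); last first.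
  by move=> A mA _; rewrite -[LHS](lebesgue_rV_aff a l0 mA).
rewrite ge0_integral_mscale//; congr (_ * _)%E.
by rewrite ge0_integral_pushforward//; exact: measurable_aff.
Qed.

End affine.

(** * The bump functions t^(-m) exp(-1/t) *)

Section bump.
Context {R : realType}.

(** The powers of 1/t make the family closed under differentiation up to linear combinations, so
    smoothness of exp(-1/t) needs no separate induction. *)
Definition bump (m : nat) (t : R) : R :=
  if 0 < t then t^-1 ^+ m * expR (- t^-1) else 0.

Lemma bump_npos m t : t <= 0 -> bump m t = 0.
Proof. by rewrite /bump ltNge => ->. Qed.

Lemma bump_ge0 m t : 0 <= bump m t.
Proof.
rewrite /bump; case: ifPn => // t0.
by rewrite mulr_ge0 ?expR_ge0// exprn_ge0// invr_ge0 ltW.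
Qed.

Lemma bump_gt0 m t : 0 < t -> 0 < bump m t.
Proof. by move=> t0; rewrite /bump t0 mulr_gt0 ?expR_gt0// exprn_gt0// invr_gt0. Qed.

(** With x = 1/t this is x^m / m! <= exp x, a single term of the exponential series. *)
Lemma bump_le m t : bump m t <= m`!%:R.
Proof.
rewrite /bump; case: ifPn => // t0.
rewrite expRN ler_pdivrMr ?expR_gt0//.
have it0 : 0 <= t^-1 by rewrite invr_ge0 ltW.
case: m => [|m]; first by rewrite expr0 fact0 mul1r; have := expR_ge1Dx t^-1; lra.
rewrite -ler_pdivrMl ?ltr0n ?fact_gt0// mulrC.
by apply: le_trans (expR_ge1Dxn _ it0); rewrite ler_wpDl.
Qed.

Lemma bumpS m t : bump m t = t * bump m.+1 t.
Proof.
rewrite /bump; case: ifPn => [t0|_]; last by rewrite mulr0.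
by rewrite exprS !mulrA divff ?mul1r// gt_eqF.
Qed.

Global Instance is_derive_bump m (t : R) :
  is_derive t (1 : R) (bump m) (bump m.+2 t - m%:R * bump m.+1 t).
Proof.
have [t0|t0|t0] := ltgtP 0 t.
- apply: (@near_eq_is_derive _ _ _ (fun t : R => t^-1 ^+ m * expR (- t^-1))).
    near=> z; rewrite /bump; suff -> : 0 < z by [].
    by near: z; exact: lt_nbhsr.
  have tn0 : t != 0 by rewrite gt_eqF.
  have dV : is_derive t (1 : R) (fun t : R => t^-1) (- t ^- 2).
    by apply: is_derive_eq; [exact: is_deriveV|rewrite scaler1].
  have dE : is_derive t (1 : R) (fun t : R => expR (- t^-1)) (expR (- t^-1) * (- - t ^- 2)).
    apply: (@is_derive1_comp _ expR (fun t : R => - t^-1)).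
  rewrite (_ : (fun t : R => _) =
    (fun t : R => t^-1) ^+ m * (fun t : R => expR (- t^-1))); last first.
    by apply/funext => z; rewrite !fctE.
  apply: is_derive_eq.
  rewrite !fctE /bump t0 /GRing.scale/=.
  by case: m => [|m]; rewrite /= ?exprS; field.
- apply: (@near_eq_is_derive _ _ _ (cst (0:R))).
    near=> z; rewrite bump_npos//.
    by apply/ltW; near: z; exact: lt_nbhsl.
  by rewrite !bump_npos ?ltW// mulr0 subrr; exact: is_derive_cst.
(* At 0 the difference quotient is [bump m.+1] by [bumpS], and a second use of [bumpS] bounds it by
   |z| (m+2)!. *)
- rewrite -t0 !bump_npos// mulr0 subrr.
  apply/is_derive1_caratheodory; exists (bump m.+1); split.
  + by move=> z; rewrite [bump m 0]bump_npos// !subr0 bumpS mulrC.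
  + apply/cvgrPdist_le => e e0.
    have e'0 : 0 < e / m.+2`!%:R by rewrite divr_gt0// ltr0n fact_gt0.
    have := @nbhs0_le _ R _ e'0; apply: filterS => z ze.
    rewrite bump_npos// sub0r normrN bumpS normrM.
    rewrite (ger0_norm (bump_ge0 _ _)).
    apply: (@le_trans _ _ (`|z| * m.+2`!%:R)); first by rewrite ler_wpM2l ?bump_le.
    by rewrite -ler_pdivlMr ?ltr0n ?fact_gt0.
  + by rewrite bump_npos.
Unshelve. all: end_near.
Qed.

Lemma bump_lip m : exists2 C : R, 0 <= C &
  forall s t, `|bump m s - bump m t| <= C * `|s - t|.
Proof.
exists (m.+2`!%:R + m%:R * m.+1`!%:R); first by rewrite addr_ge0// mulr_ge0.
have le_st s t : s <= t -> `|bump m t - bump m s| <=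
    (m.+2`!%:R + m%:R * m.+1`!%:R) * `|t - s|.
  move=> st.
  have [|c _ ->] := @MVT_segment R (bump m) _ s t st
    (fun x _ => is_derive_bump m x).
    by apply: derivable_within_continuous => x _; case: (is_derive_bump m x).
  rewrite normrM ler_wpM2r// (le_trans (ler_normB _ _))// lerD//.
    by rewrite ger0_norm ?bump_ge0 ?bump_le.
  by rewrite normrM ger0_norm// ler_wpM2l// ger0_norm ?bump_ge0 ?bump_le.
move=> s t; have [st|/ltW ts] := leP s t; last exact: le_st.
by rewrite distrC [`|s - t|]distrC; exact: le_st.
Qed.

(** With q the squared distance to the center, these are the terms produced by differentiating a
    rescaled radial kernel in the inverse radius l; their span is stable under d/dl. *)
Definition mono_bump (k j m : nat) (q l : R) : R :=
  l ^+ k * q ^+ j * bump m (1 - l ^+ 2 * q).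

Global Instance is_derive_mono_bump k j m q (l : R) :
  is_derive l (1 : R) (mono_bump k j m q)
    (k%:R * mono_bump k.-1 j m q l - 2 * mono_bump k.+1 j.+1 m.+2 q l
     + (2 * m)%:R * mono_bump k.+1 j.+1 m.+1 q l).
Proof.
have d1 : is_derive l (1 : R) (fun l : R => l ^+ k) (k%:R * l ^+ k.-1).
  rewrite (_ : (fun l : R => _) = id ^+ k); last first.
    by apply/funext => z; rewrite !fctE.
  by apply: is_derive_eq; rewrite /GRing.scale/= mulr1.
have d2 : is_derive l (1 : R) (fun l : R => 1 - l ^+ 2 * q) (- (2 * l * q)).
  rewrite (_ : (fun l : R => _) = cst 1 - (id ^+ 2) * cst q); last first.
    by apply/funext => z; rewrite !fctE.
  apply: is_derive_eq; rewrite /GRing.scale/=; ring.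
have d3 : is_derive l (1 : R) (fun l : R => bump m (1 - l ^+ 2 * q))
   ((bump m.+2 (1 - l ^+ 2 * q) - m%:R * bump m.+1 (1 - l ^+ 2 * q)) * (- (2 * l * q))).
  exact: (@is_derive1_comp _ (bump m) (fun l : R => 1 - l ^+ 2 * q)).
rewrite (_ : mono_bump k j m q = (fun l : R => l ^+ k) * cst (q ^+ j) *
    (fun l : R => bump m (1 - l ^+ 2 * q))); last first.
  by apply/funext => z; rewrite !fctE.
apply: is_derive_eq; rewrite !fctE /GRing.scale/= /mono_bump natrM !exprS; ring.
Qed.

(** Uniformity in q comes from the support: the bump vanishes unless l^2 q < 1, and then a <= l
    forces q <= a^(-2). *)
Lemma mono_bump_bound k j m (a b : R) : 0 < a -> exists2 C : R, 0 <= C &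
  forall q l, 0 <= q -> a <= l <= b -> `|mono_bump k j m q l| <= C.
Proof.
move=> a0; exists (`|b| ^+ k * (a ^-1 ^+ 2) ^+ j * m`!%:R).
  by rewrite !mulr_ge0// ?exprn_ge0// ?exprn_ge0// invr_ge0 ltW.
move=> q l q0 /andP[al lb]; rewrite /mono_bump.
have l0 : 0 < l by apply: lt_le_trans al.
have [h|h] := leP (1 - l ^+ 2 * q) 0.
  rewrite bump_npos// mulr0 normr0.
  by rewrite !mulr_ge0// ?exprn_ge0// ?exprn_ge0// invr_ge0 ltW.
rewrite !normrM; apply: ler_pM => //.
- apply: ler_pM => //; rewrite normrX lerXn2r ?nnegrE//.
  + by rewrite (ger0_norm (ltW l0)); apply: (le_trans lb); exact: ler_norm.
  + by rewrite exprn_ge0// invr_ge0 ltW.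
  + rewrite ger0_norm// exprVn -[leRHS]mul1r ler_pdivlMr ?exprn_gt0//.
    apply: (@le_trans _ _ (q * l ^+ 2)); last lra.
    by rewrite ler_wpM2l// lerXn2r ?nnegrE// ltW.
- by rewrite ger0_norm ?bump_ge0// bump_le.
Qed.

Lemma mono_bump_lip k j m (a b : R) : 0 < a -> exists2 C : R, 0 <= C &
  forall q l l', 0 <= q -> a <= l <= b -> a <= l' <= b ->
   `|mono_bump k j m q l - mono_bump k j m q l'| <= C * `|l - l'|.
Proof.
move=> a0.
have [C1 C10 H1] := mono_bump_bound k.-1 j m b a0.
have [C2 C20 H2] := mono_bump_bound k.+1 j.+1 m.+2 b a0.
have [C3 C30 H3] := mono_bump_bound k.+1 j.+1 m.+1 b a0.
exists (k%:R * C1 + 2 * C2 + (2 * m)%:R * C3); first by rewrite !addr_ge0// mulr_ge0.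
move=> q l l' q0.
wlog ll' : l l' / l' <= l.
  move=> h hl hl'; have [/h|/ltW/h] := leP l' l; first exact.
  by rewrite distrC [`|l - l'|]distrC; exact.
move=> /andP[al lb] /andP[al' lb'].
have [|c] := @MVT_segment R (mono_bump k j m q) _ l' l ll'
    (fun x _ => is_derive_mono_bump k j m q x).
  by apply: derivable_within_continuous => x _; case: (is_derive_mono_bump k j m q x).
rewrite in_itv/= => /andP[l'c cl] ->.
have abc : a <= c <= b by rewrite (le_trans al')// (le_trans cl).
rewrite normrM ler_wpM2r// (le_trans (ler_normD _ _))// lerD//.
  rewrite (le_trans (ler_normB _ _))// lerD// normrM ger0_norm// ler_wpM2l//.
    exact: H1.
  exact: H2.
by rewrite normrM ger0_norm// ler_wpM2l//; exact: H3.
Qed.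

End bump.

(** * Smooth and test functions *)

Section elementary.
Context {R : realType} {n : nat}.
Local Notation V := ('rV[R]_n).
Local Notation e_ i := (delta_mx ord0 i : V).

(* A class of functions stable under partial derivatives by construction, so that
   its members are smooth. *)
Inductive elem : (V -> R) -> Prop :=
| elem_cst c : elem (fun=> c)
| elem_coor i : elem (fun x => x ord0 i)
| elemD f g : elem f -> elem g -> elem (fun x => f x + g x)
| elemM f g : elem f -> elem g -> elem (fun x => f x * g x)
| elem_bump m f : elem f -> elem (fun x => bump m (f x)).

Lemma is_derive_comp_rV (f : V -> R) (g : R -> R) (x v : V) (dg : R) :
  differentiable f x -> is_derive (f x) (1 : R) g dg ->
  is_derive x v (fun x => g (f x)) (dg * 'D_v f x).
Proof.
move=> df [dg1 dgE].
have dg' : differentiable g (f x) by exact/derivable1_diffP.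
have dgf : differentiable (g \o f) x by exact: differentiable_comp.
apply: (@DeriveDef _ _ _ _ _ (g \o f)); first exact: diff_derivable.
rewrite deriveE// diff_comp//= -(deriveE v df).
have -> w : 'd g (f x) w = w * 'd g (f x) 1.
  by rewrite -[w in LHS]mulr1; exact: linearZ.
by rewrite -deriveE// dgE mulrC.
Qed.

Lemma elem_differentiable f : elem f -> forall x, differentiable f x.
Proof.
elim => {f} [c|i|f g _ df _ dg|f g _ df _ dg|m f _ df] x.
- exact: differentiable_cst.
- exact: differentiable_coord.
- exact: differentiableD.
- exact: differentiableM.
- apply: (@differentiable_comp _ _ _ _ f (bump m)) => //.
  by apply/derivable1_diffP; case: (is_derive_bump m (f x)).
Qed.

Lemma derive_coor (i j : 'I_n) (x : V) : 'D_(e_ i) (fun x : V => x ord0 j) x = (i == j)%:R.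
Proof.
have @f : {linear V -> R}.
  by exists (fun N : V => N ord0 j); do 2![eexists]; do ?[constructor];
     rewrite ?mxE// => ? *; rewrite ?mxE//; move=> ?; rewrite !mxE.
rewrite -[fun x : V => _]/(f : V -> R) deriveE; last exact: differentiable_coord.
by rewrite diff_lin; [rewrite /= mxE eqxx eq_sym|exact: coord_continuous].
Qed.

Lemma elem_derive f i : elem f -> elem (fun x => 'D_(e_ i) f x).
Proof.
elim => {f} [c|j|f g ef df eg dg|f g ef df eg dg|m f ef df].
- under eq_fun do rewrite derive_cst.
  exact: elem_cst.
- under eq_fun do rewrite derive_coor.
  exact: elem_cst.
- rewrite (_ : (fun x => _) = fun x => 'D_(e_ i) f x + 'D_(e_ i) g x); first exact: elemD.
  by apply/funext => x; rewrite deriveD//; apply/diff_derivable/elem_differentiable.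
- rewrite (_ : (fun x => _) = fun x => f x * 'D_(e_ i) g x + g x * 'D_(e_ i) f x).
    by apply: elemD; exact: elemM.
  by apply/funext => x; rewrite deriveM//; apply/diff_derivable/elem_differentiable.
- rewrite (_ : (fun x => _) = fun x =>
    (bump m.+2 (f x) + (- m%:R) * bump m.+1 (f x)) * 'D_(e_ i) f x).
    apply: elemM => //; apply: elemD; first exact: elem_bump.
    by apply: elemM; [exact: elem_cst|exact: elem_bump].
  apply/funext => x; rewrite mulNr.
  by have [_ ->] := @is_derive_comp_rV f (bump m) x (e_ i) _ (elem_differentiable ef x)
     (is_derive_bump m (f x)).
Qed.

Lemma elem_partials s f : elem f -> elem (partials s f).
Proof. by elim: s => //= i s IH ef; apply: elem_derive; exact: IH. Qed.

Lemma elem_smooth f : elem f -> smooth f.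
Proof.
move=> ef s; have es := elem_partials s ef; split=> [x|i x].
  exact/differentiable_continuous/elem_differentiable.
exact/diff_derivable/elem_differentiable.
Qed.

Lemma elem_opp f : elem f -> elem (fun x => - f x).
Proof.
move=> ef; rewrite (_ : (fun x => _) = fun x => (-1) * f x).
  by apply: elemM => //; exact: elem_cst.
by apply/funext => x; rewrite mulN1r.
Qed.

Lemma elem_sum (I : eqType) (s : seq I) (F : I -> V -> R) :
  (forall i, i \in s -> elem (F i)) -> elem (fun x => \sum_(i <- s) F i x).
Proof.
elim: s => [|i s IH] H.
  under eq_fun do rewrite big_nil.
  exact: elem_cst.
under eq_fun do rewrite big_cons.
apply: elemD; first by apply: H; rewrite mem_head.
by apply: IH => j js; apply: H; rewrite inE js orbT.
Qed.

End elementary.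

Section smooth_theory.
Context {R : realType} {n : nat}.
Implicit Types (f g : 'rV[R]_n -> R).

Lemma partialsD s f g : smooth f -> smooth g ->
  partials s (fun x => f x + g x) = fun x => partials s f x + partials s g x.
Proof.
move=> sf sg; elim: s => //= i s ->; apply/funext => x.
by rewrite deriveD//; [case: (sf s)|case: (sg s)].
Qed.

Lemma partialsZ s c f : smooth f ->
  partials s (fun x => c * f x) = fun x => c * partials s f x.
Proof.
move=> sf; elim: s => //= i s ->; apply/funext => x.
by rewrite [LHS](@deriveZ _ _ _ (partials s f))//; case: (sf s).
Qed.

Lemma smoothD f g : smooth f -> smooth g -> smooth (fun x => f x + g x).
Proof.
move=> sf sg s; rewrite partialsD//; have [cf df] := sf s; have [cg dg] := sg s.
by split=> [x|i x]; [exact: cvgD (cf x) (cg x)|exact: derivableD].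
Qed.

Lemma smoothZ c f : smooth f -> smooth (fun x => c * f x).
Proof.
move=> sf s; rewrite partialsZ//; have [cf df] := sf s.
split=> [x|i x]; first exact: cvgMr (cf x).
exact: (@derivableZ _ _ _ (partials s f)).
Qed.

Lemma smooth_partials s f : smooth f -> smooth (partials s f).
Proof. by move=> sf t; rewrite /partials -foldr_cat; exact: sf. Qed.

Lemma smooth_continuous f : smooth f -> continuous f.
Proof. by move=> /(_ [::])[]. Qed.

Lemma test_functionD D f g : test_function D f -> test_function D g ->
  test_function D (fun x => f x + g x).
Proof.
move=> [sf [K [cK KD fK]]] [sg [L [cL LD gL]]]; split; first exact: smoothD.
exists (K `|` L); split.
- exact: compactU.
- by move=> x [/KD|/LD].
- by move=> x KLx; rewrite fK ?gL ?addr0// => h; apply: KLx; [right|left].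
Qed.

Lemma test_functionZ D c f : test_function D f -> test_function D (fun x => c * f x).
Proof.
move=> [sf [K [cK KD fK]]]; split; first exact: smoothZ.
by exists K; split => // x Kx; rewrite fK ?mulr0.
Qed.

Lemma test_functionS D E f : D `<=` E -> test_function D f -> test_function E f.
Proof.
by move=> DE [sf [K [cK KD fK]]]; split=> //; exists K; split=> // x /KD/DE.
Qed.

Lemma test_function_sum (I : Type) (s : seq I) D (F : I -> 'rV[R]_n -> R) :
  (forall i, test_function D (F i)) -> test_function D (fun x => \sum_(i <- s) F i x).
Proof.
move=> H; elim: s => [|i s IH].
  under eq_fun do rewrite big_nil.
  split; first exact: elem_smooth (elem_cst 0).
  by exists set0; split => //; exact: compact0.
under eq_fun do rewrite big_cons.
exact: test_functionD.
Qed.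

Lemma test_function_partials D s f : test_function D f -> test_function D (partials s f).
Proof.
move=> [sf [K [cK KD fK]]]; split; first exact: smooth_partials.
exists K; split => //; elim: s => // i s IH x Kx /=.
have oK : open (~` K) by apply: closed_openC; apply: compact_closed.
rewrite (@near_eq_derive _ _ _ _ (cst (0 : R))) ?derive_cst//.
by apply: filterS (open_nbhs_nbhs (conj oK Kx)) => y; exact: IH.
Qed.

End smooth_theory.

(** * Real-valued integrals and compact supports *)

Section real_integrals.
Context d (T : measurableType d) (R : realType) (mu : {measure set T -> \bar R}).
Implicit Types (D E : set T) (f g h : T -> R).
Local Notation intble D f := (mu.-integrable D (EFin \o f)).

Lemma intble_measurable D f : intble D f -> measurable_fun D f.
Proof. by case/integrableP => /measurable_EFinP. Qed.

Lemma intbleS D E f : measurable D -> measurable E -> E `<=` D -> intble D f -> intble E f.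
Proof. by move=> mD mE ED; exact: integrableS. Qed.

Lemma intbleD D f g : measurable D -> intble D f -> intble D g ->
  intble D (fun x => f x + g x).
Proof.
move=> mD If Ig; rewrite (_ : _ \o _ = (EFin \o f) \+ (EFin \o g))%E.
  exact: integrableD.
by apply/funext => x.
Qed.

Lemma intbleZ D c f : measurable D -> intble D f -> intble D (fun x => c * f x).
Proof.
move=> mD If; rewrite (_ : _ \o _ = (fun x => c%:E * (EFin \o f) x)%E).
  exact: integrableZl.
by apply/funext => x.
Qed.

Lemma intbleB D f g : measurable D -> intble D f -> intble D g ->
  intble D (fun x => f x - g x).
Proof.
move=> mD If Ig; rewrite (_ : _ \o _ = (EFin \o f) \- (EFin \o g))%E.
  exact: integrableB.
by apply/funext => x.
Qed.

Lemma intble_le D f g : measurable D -> measurable_fun D f ->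
  (forall x, D x -> `|f x| <= g x) -> intble D g -> intble D f.
Proof.
move=> mD mf fg; apply: le_integrable => //; first exact/measurable_EFinP.
move=> x Dx /=; rewrite lee_fin; apply: le_trans (fg _ Dx) _; exact: ler_norm.
Qed.

Lemma intbleM D f g (M : R) : measurable D -> intble D f -> measurable_fun D g ->
  (forall x, D x -> `|g x| <= M) -> intble D (fun x => f x * g x).
Proof.
move=> mD If mg gM.
apply: (@intble_le _ _ (fun x => M * `|f x|)) => //.
- by apply: measurable_funM => //; exact: intble_measurable.
- by move=> x Dx; rewrite normrM mulrC ler_wpM2r// gM.
- by apply: intbleZ => //; exact: integrable_norm.
Qed.

Lemma intble_bounded D f (M : R) : measurable D -> (mu D < +oo)%E ->
  measurable_fun D f -> (forall x, D x -> `|f x| <= M) -> intble D f.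
Proof.
move=> mD Dfin mf fM; apply: measurable_bounded_integrable => //.
by exists M; split; [exact: num_real|move=> N MN x Dx; exact: le_trans (fM _ Dx) (ltW MN)].
Qed.

Lemma intble_sum D (I : Type) (s : seq I) (F : I -> T -> R) : measurable D ->
  (forall i, intble D (F i)) -> intble D (fun x => \sum_(i <- s) F i x).
Proof.
move=> mD IF; elim: s => [|i s IH].
  under eq_fun do rewrite big_nil.
  by rewrite (_ : _ \o _ = cst 0%E)//; exact: integrable0.
under eq_fun do rewrite big_cons.
exact: intbleD.
Qed.

Lemma Rint_sum D (I : Type) (s : seq I) (F : I -> T -> R) : measurable D ->
  (forall i, intble D (F i)) ->
  \int[mu]_(x in D) (\sum_(i <- s) F i x) = \sum_(i <- s) \int[mu]_(x in D) F i x.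
Proof.
move=> mD IF; elim: s => [|i s IH].
  rewrite big_nil (_ : (fun x => _) = cst 0).
    by rewrite Rintegral_cst// mul0r.
  by apply/funext => x; rewrite big_nil.
rewrite big_cons -IH -RintegralD//; last exact: intble_sum.
by apply: eq_Rintegral => x _; rewrite big_cons.
Qed.

Lemma Rint_sub D E f : E `<=` D -> (forall x, D x -> ~ E x -> f x = 0) ->
  \int[mu]_(x in D) f x = \int[mu]_(x in E) f x.
Proof.
move=> ED f0; rewrite Rintegral_mkcond [RHS]Rintegral_mkcond.
congr (Rintegral _ _ _); apply/funext => x; rewrite /patch.
case: (boolP (x \in D)); case: (boolP (x \in E)) => //.
  by rewrite !inE/= => xE xD; rewrite f0//; move/negP: xE; rewrite inE.
by rewrite !inE => /ED xD; rewrite mem_set.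
Qed.

Lemma intble_sub D E f : measurable D -> measurable E -> E `<=` D ->
  (forall x, D x -> ~ E x -> f x = 0) -> intble E f -> intble D f.
Proof.
move=> mD mE ED f0 /(integrable_mkcond _ mE) If.
apply/(integrable_mkcond _ mD).
rewrite [X in _.-integrable _ X](_ : _ = ((EFin \o f) \_ E))//.
apply/funext => x; rewrite /patch.
case: (boolP (x \in D)); case: (boolP (x \in E)) => //.
  by rewrite !inE/= => xE xD; rewrite f0//; move/negP: xE; rewrite inE.
by rewrite !inE => /ED xD; rewrite mem_set.
Qed.

Lemma Rint_norm_le D f g : measurable D -> measurable_fun D f -> intble D g ->
  (forall x, D x -> `|f x| <= g x) ->
  `|\int[mu]_(x in D) f x| <= \int[mu]_(x in D) g x.
Proof.
move=> mD mf Ig fg; have If := intble_le mD mf fg Ig.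
apply: le_trans (le_normr_Rintegral mD If) _.
by apply: le_Rintegral => //; exact: integrable_norm.
Qed.

Lemma le_Rint_set D E f : measurable D -> measurable E -> E `<=` D ->
  intble D f -> (forall x, D x -> 0 <= f x) ->
  \int[mu]_(x in E) f x <= \int[mu]_(x in D) f x.
Proof.
move=> mD mE ED If f0; rewrite /Rintegral fine_le//.
- by apply: integrable_fin_num => //; exact: intbleS If.
- exact: integrable_fin_num.
- apply: ge0_subset_integral => //.
  by case/integrableP : If.
Qed.

Lemma Rint_EFin D f : measurable D -> intble D f ->
  (\int[mu]_(x in D) f x)%:E = (\int[mu]_(x in D) (f x)%:E)%E.
Proof. by move=> mD If; rewrite fineK//; exact: integrable_fin_num. Qed.

End real_integrals.

Section compact_support.
Context {R : realType} {n : nat}.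
Local Notation V := ('rV[R]_n).
Local Notation mu := (@lebesgue_rV R n).

Lemma rV_norm_lt (x : V) (r : R) : 0 < r -> (`|x| < r) <-> forall i, `|x ord0 i| < r.
Proof.
move=> r0; have -> : `|x| < r <-> ball 0 r x.
  by rewrite mx_norm_ball /ball_/= sub0r normrN.
split=> [/rV_ballP[_ h] i|h]; first by have := h i; rewrite mxE sub0r normrN.
by apply/rV_ballP; split => // i; rewrite mxE sub0r normrN.
Qed.

Lemma rV_norm_coor (x : V) i : `|x ord0 i| <= `|x|.
Proof.
apply/ler_addgt0Pr => e e0; apply/ltW; apply: (rV_norm_lt x _).1.
  by rewrite ltr_wpDl.
by rewrite ltrDl.
Qed.

Lemma rV_ballE (x y : V) (r : R) : ball x r y <-> `|x - y| < r.
Proof. by rewrite mx_norm_ball. Qed.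

Lemma bounded_sub_ball (A : set V) : bounded_set A ->
  exists2 r : R, 0 < r & A `<=` ball 0 r.
Proof.
move=> [M [_ hM]]; exists (`|M| + 2); first by rewrite ltr_wpDl.
move=> x Ax; rewrite rV_ballE sub0r normrN.
apply: (@le_lt_trans _ _ (`|M| + 1)); last by rewrite ltrD2l ltr1n.
by apply: (hM (`|M| + 1)) => //; rewrite ltr_pwDr// ler_norm.
Qed.

Lemma bounded_finite_measure (A : set V) : measurable A -> bounded_set A ->
  (mu A < +oo)%E.
Proof.
move=> mA /bounded_sub_ball[r r0 Ar]; apply: (@le_lt_trans _ _ (mu (ball 0 r))).
  by apply: le_measure => //; rewrite inE//; exact: measurable_ball_rV.
by rewrite lebesgue_rV_ball// ltry.
Qed.

Lemma compact_le_ball (x : V) (r : R) : compact [set y : V | `|x - y| <= r].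
Proof.
apply: bounded_closed_compact.
  exists (`|x| + r); split; first exact: num_real.
  move=> M hM y /= h; apply: le_trans (ltW hM).
  by have := ler_normB x (x - y); rewrite subKr; lra.
rewrite [X in closed X](_ : _ = (fun y => `|x - y|) @^-1` [set t | t <= r])//.
apply: preimage_closed; last exact: closed_le.
have cB : continuous (fun y : V => x - y).
  by move=> y; apply: differentiable_continuous; apply: differentiableB.
by move=> y _; exact: cvg_norm (cB y).
Qed.

Lemma compact_support_bounded (f : V -> R) K : continuous f -> compact K ->
  (forall x, ~ K x -> f x = 0) -> exists2 M : R, 0 <= M & forall x, `|f x| <= M.
Proof.
move=> cf cK fK; have : compact (f @` K).
  by apply: continuous_compact => //; exact: continuous_subspaceT.
move=> /compact_bounded[M [_ hM]]; exists (`|M| + 1); first by rewrite addr_ge0.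
move=> x; have [Kx|Kx] := pselect (K x); last by rewrite fK// normr0 addr_ge0.
by apply: hM; [rewrite ltr_pwDr// ler_norm|exists x].
Qed.

Lemma compact_support_intble (f : V -> R) K D : continuous f -> compact K ->
  (forall x, ~ K x -> f x = 0) -> measurable D -> mu.-integrable D (EFin \o f).
Proof.
move=> cf cK fK mD; have mK := compact_measurable_rV cK.
have mf := continuous_measurable_rV cf.
apply: (@intbleS _ _ _ _ setT) => //.
apply: (@intble_sub _ _ _ _ _ K) => //; first by move=> x _; exact: fK.
have [M M0 fM] := compact_support_bounded cf cK fK.
apply: (@intble_bounded _ _ _ _ _ _ M) => //.
  exact: bounded_finite_measure (compact_bounded cK).
exact: measurable_funS mf.
Qed.

Lemma is_derive_line (f : V -> R) (x v : V) (t df : R) :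
  is_derive (t *: v + x) v f df -> is_derive t (1 : R) (fun t => f (t *: v + x)) df.
Proof.
move=> [dv dE]; have E : (fun h : R => h^-1 *:
      (((fun t => f (t *: v + x)) \o shift t) (h *: (1:R)) - f (t *: v + x))) =
    (fun h : R => h^-1 *: ((f \o shift (t *: v + x)) (h *: v) - f (t *: v + x))).
  apply/funext => h; congr (_ *: (_ - _)).
  by rewrite /= [h *: (1 : R)]mulr1 scalerDl addrA.
by split; [rewrite /derivable E|rewrite /derive E].
Qed.

Lemma integral_shift (a : V) (f : V -> \bar R) : measurable_fun setT f ->
  (\int[mu]_x f (x + a)%R = \int[mu]_x f x)%E.
Proof.
move=> mf.
have H (g : V -> \bar R) : measurable_fun setT g -> (forall x, 0 <= g x)%E ->
    (\int[mu]_x g (x + a)%R = \int[mu]_x g x)%E.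
  move=> mg g0; rewrite -(integral_lebesgue_rV_aff a ltr01 mg g0) expr1n mul1e.
  by apply: eq_integral => x _; rewrite /aff scale1r.
rewrite [LHS]integralE [RHS]integralE; congr (_ - _)%E.
  rewrite -[RHS]H//; last exact: measurable_funepos.
  by apply: eq_integral => x _; rewrite !funeposE.
rewrite -[RHS]H//; last exact: measurable_funeneg.
by apply: eq_integral => x _; rewrite !funenegE.
Qed.

End compact_support.

(** * Integration by parts *)

Section integration_by_parts.
Context {R : realType} {n : nat}.
Local Notation V := ('rV[R]_n).
Local Notation mu := (@lebesgue_rV R n).
Local Notation e_ i := (delta_mx ord0 i : V).

Lemma ball_lty (x : V) (r : R) : (mu (ball x r) < +oo)%E.
Proof.
have [r0|r0] := ltP 0 r; first by rewrite lebesgue_rV_ball// ltry.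
suff -> : ball x r = set0 by rewrite measure0.
by rewrite -subset0 => y /rV_ballP[]; rewrite ltNge r0.
Qed.

Lemma derive_off (f : V -> R) (K : set V) v : closed K ->
  (forall x, ~ K x -> f x = 0) -> forall x, ~ K x -> 'D_v f x = 0.
Proof.
move=> cK fK x Kx.
rewrite (@near_eq_derive _ _ _ _ (cst (0 : R))) ?derive_cst//.
by apply: filterS (open_nbhs_nbhs (conj (closed_openC cK) Kx)) => y; exact: fK.
Qed.

Lemma le_line_increment (f : V -> R) (v x : V) (M h : R) : 0 <= h ->
  (forall x, derivable f x v) -> (forall x, `|'D_v f x| <= M) ->
  `|f (h *: v + x) - f x| <= M * h.
Proof.
move=> h0 df DM.
have H (t : R) : is_derive t (1 : R) (fun t => f (t *: v + x)) ('D_v f (t *: v + x)).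
  by apply: is_derive_line; exact: derivableP.
have [|c _] := @MVT_segment R (fun t => f (t *: v + x)) _ 0 h h0 (fun t _ => H t).
  by apply: derivable_within_continuous => t _; case: (H t).
rewrite scale0r add0r subr0 => ->; rewrite normrM (ger0_norm h0).
by rewrite ler_wpM2r.
Qed.

Lemma norm_e_ i : `|e_ i| <= 1.
Proof.
apply/ler_addgt0Pr => e e0; apply/ltW; apply/rV_norm_lt; first by rewrite ltr_wpDl.
move=> j; rewrite mxE eqxx/=; case: eqP => _ /=; rewrite ?normr1 ?normr0; lra.
Qed.

(** By translation invariance every difference quotient of f has integral 0, and dominated
    convergence passes this to the derivative, without Fubini. *)
Lemma Rint_derive0 (f : V -> R) (i : 'I_n) (K : set V) :
  continuous f -> (forall x, derivable f x (e_ i)) ->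
  continuous (fun x => 'D_(e_ i) f x) -> compact K ->
  (forall x, ~ K x -> f x = 0) ->
  \int[mu]_x 'D_(e_ i) f x = 0.
Proof.
move=> cf df cD cK fK.
have clK : closed K by exact: compact_closed.
have DK := @derive_off f K (e_ i) clK fK.
have [M M0 DM] := compact_support_bounded cD cK DK.
have [r r0 Kr] := bounded_sub_ball (compact_bounded cK).
have mf := continuous_measurable_rV cf.
pose F (k : nat) (x : V) : R := k.+1%:R * (f (x + k.+1%:R^-1 *: e_ i) - f x).
have mshift (k : nat) : measurable_fun setT (fun x : V => f (x + k.+1%:R^-1 *: e_ i)).
  apply: continuous_measurable_rV => x.
  apply: (@continuous_comp _ _ _ (fun x : V => x + k.+1%:R^-1 *: e_ i) f); last exact: cf.
  by apply: differentiable_continuous; apply: differentiableD.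
have ifs (k : nat) : mu.-integrable setT (EFin \o (fun x : V => f (x + k.+1%:R^-1 *: e_ i))).
  apply/integrableP; split; first exact/measurable_EFinP.
  have If : mu.-integrable setT (EFin \o f) by exact: compact_support_intble cK _ _.
  under eq_integral do rewrite /=.
  rewrite (@integral_shift _ _ (k.+1%:R^-1 *: e_ i) (fun x : V => `|f x|%:E)).
    by case/integrableP : If.
  by apply/measurable_EFinP; exact: measurableT_comp.
have intF k : (\int[mu]_x (F k x)%:E = 0)%E.
  have If : mu.-integrable setT (EFin \o f) by exact: compact_support_intble cK _ _.
  rewrite -Rint_EFin//; last by apply: intbleZ => //; exact: intbleB.
  rewrite RintegralZl//; last exact: intbleB.
  rewrite RintegralB// {1}/Rintegral (@integral_shift _ _ _ (EFin \o f)).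
    by rewrite subrr mulr0.
  exact/measurable_EFinP.
have k1 (k : nat) : k.+1%:R^-1 <= 1 :> R by rewrite invf_le1 ?ler1n.
(* The quotients are at most M by the mean value theorem, and they vanish off the ball of radius r +
   1 because the shifts have length at most 1. *)
have [|||||_ _] := @dominated_convergence _ _ _ mu setT measurableT
  (fun k (x : V) => (F k x)%:E) (fun x : V => ('D_(e_ i) f x)%:E)
  (fun x : V => (M * \1_(ball (0 : V) (r + 1)) x)%:E).
- by move=> k; apply/measurable_EFinP; apply: measurable_funM => //; exact: measurable_funB.
- by apply/measurable_EFinP; exact: continuous_measurable_rV.
- apply: aeW => x _; apply: cvg_EFin; first exact: nearW.
  have H : h^-1 *: ((f \o shift x) (h *: e_ i) - f x) @[h --> 0^'] --> 'D_(e_ i) f x.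
    exact: df x.
  rewrite [X in X @ _ --> _](_ : _ = (fun h : R => h^-1 *:
    ((f \o shift x) (h *: e_ i) - f x)) \o harmonic); last first.
    apply/funext => k; rewrite /F /harmonic/= invrK.
    by congr (_ * (f _ - _)); rewrite addrC.
  apply: (cvg_comp _ _ _ H) => A; rewrite nbhs_simpl /= /dnbhs /within/= => hA.
  have H0 : \forall k \near \oo, (@harmonic R k != 0 -> A (@harmonic R k)).
    exact: (@cvg_harmonic R _ hA).
  by apply: filterS H0 => k /=; apply; rewrite invr_eq0 pnatr_eq0.
- have mB := measurable_ball_rV (0 : V) (r + 1).
  apply: (@intbleZ _ _ _ _ setT M (\1_(ball (0 : V) (r + 1)) : V -> R)) => //.
  apply: (@intble_sub _ _ _ _ setT (ball (0 : V) (r + 1))) => //.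
    by move=> x _ ?; rewrite indicE memNset.
  apply: (@intble_bounded _ _ _ _ _ _ 1) => //.
  + exact: ball_lty.
  + by move=> x _; rewrite indicE; case: (_ \in _); rewrite ?normr1 ?normr0.
- apply: aeW => x k _; rewrite lee_fin indicE.
  have k0 : 0 <= k.+1%:R^-1 :> R by rewrite invr_ge0.
  have [xB|xB] := boolP (x \in _).
    rewrite mulr1 /F normrM normr_nat -ler_pdivlMl ?ltr0n// mulrC [x + _]addrC.
    exact: le_line_increment.
  rewrite mulr0 /F !fK ?subrr ?mulr0 ?normr0//.
    move=> /Kr; rewrite rV_ballE sub0r normrN => xr; move/negP: xB; apply; rewrite inE.
    by rewrite rV_ballE sub0r normrN; lra.
  move=> /Kr; rewrite rV_ballE sub0r normrN => xr; move/negP: xB; apply; rewrite inE.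
  rewrite rV_ballE sub0r normrN -[x](addrK (k.+1%:R^-1 *: e_ i)).
  rewrite (le_lt_trans (ler_normB _ _))// ltr_leD// normrZ ger0_norm//.
  by rewrite -[leRHS]mulr1 ler_pM// norm_e_.
rewrite (_ : [sequence _]_k = cst 0%E); last by apply/funext => k /=; exact: intF.
rewrite /Rintegral => h.
suff -> : (\int[mu]_x ('D_(e_ i) f x)%:E = 0)%E by [].
apply/esym; apply: cvg_unique h; first exact: ereal_hausdorff.
exact: cvg_cst.
Qed.

End integration_by_parts.

(** * Weak derivatives and admissible perturbations *)

Section weak_derivatives.
Context {R : realType} {n : nat}.
Local Notation V := ('rV[R]_n).
Local Notation mu := (@lebesgue_rV R n).
Local Notation e_ i := (delta_mx ord0 i : V).
Context (Omega : set V) (oOmega : open Omega).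

Let mOmega : measurable Omega. Proof. exact: open_measurable_rV. Qed.

Lemma L1loc_continuous (f : V -> R) : continuous f -> L1loc Omega f.
Proof.
move=> cf; have mf := continuous_measurable_rV cf.
split=> [|K cK KO]; first exact: measurable_funS mf.
have mK := compact_measurable_rV cK.
have : compact (f @` K) by apply: continuous_compact => //; exact: continuous_subspaceT.
move=> /compact_bounded[M [_ hM]].
apply: (@intble_bounded _ _ _ _ _ _ (`|M| + 1)) => //.
- exact: bounded_finite_measure (compact_bounded cK).
- exact: measurable_funS mf.
- by move=> x Kx; apply: hM; [rewrite ltr_pwDr// ler_norm|exists x].
Qed.

Lemma L1locD (f g : V -> R) : L1loc Omega f -> L1loc Omega g ->
  L1loc Omega (fun x => f x + g x).
Proof.
move=> [mf If] [mg Ig]; split; first exact: measurable_funD.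
move=> K cK KO; have mK := compact_measurable_rV cK.
by apply: intbleD => //; [exact: If|exact: Ig].
Qed.

Lemma L1locZ c (f : V -> R) : L1loc Omega f -> L1loc Omega (fun x => c * f x).
Proof.
move=> [mf If]; split; first exact: measurable_funM.
move=> K cK KO; have mK := compact_measurable_rV cK.
by apply: intbleZ => //; exact: If.
Qed.

Lemma test_function_bounded D (f : V -> R) : test_function D f ->
  exists2 M : R, 0 <= M & forall x, `|f x| <= M.
Proof.
by move=> [sf [K [cK KD fK]]]; exact: compact_support_bounded (smooth_continuous sf) cK fK.
Qed.

Lemma test_function_measurable D (f : V -> R) : test_function D f ->
  measurable_fun setT f.
Proof. by move=> [sf _]; apply: continuous_measurable_rV; exact: smooth_continuous. Qed.

Lemma intble_L1loc_test (f phi : V -> R) : L1loc Omega f -> test_function Omega phi ->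
  mu.-integrable Omega (EFin \o (fun x => f x * phi x)).
Proof.
move=> [mf If] tphi; have mphi := test_function_measurable tphi.
have [M M0 phiM] := test_function_bounded tphi.
have [_ [K [cK KO phiK]]] := tphi.
have mK := compact_measurable_rV cK.
apply: (@intble_sub _ _ _ _ _ K) => //; first by move=> x _ /phiK ->; rewrite mulr0.
apply: (@intbleM _ _ _ _ _ _ _ M) => //; first exact: If.
exact: measurable_funS mphi.
Qed.

Lemma smooth_derive (f : V -> R) i : smooth f -> smooth (fun x => 'D_(e_ i) f x).
Proof. by move=> sf; have := @smooth_partials _ _ [:: i] f sf. Qed.

Lemma Rint_parts1 (f g : V -> R) i : smooth f -> test_function Omega g ->
  \int[mu]_(x in Omega) (f x * 'D_(e_ i) g x) =
  - \int[mu]_(x in Omega) ('D_(e_ i) f x * g x).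
Proof.
move=> sf tg; have sg := tg.1; have [K [cK KO gK]] := tg.2.
have tDg : test_function Omega (fun x => 'D_(e_ i) g x).
  exact: (@test_function_partials _ _ _ [:: i]).
have cf := smooth_continuous sf; have cg := smooth_continuous sg.
have cDf := smooth_continuous (smooth_derive i sf).
have cDg := smooth_continuous tDg.1.
have df x : derivable f x (e_ i) by case: (sf [::]).
have dg x : derivable g x (e_ i) by case: (sg [::]).
have DE x : 'D_(e_ i) (fun x => f x * g x) x = f x * 'D_(e_ i) g x + g x * 'D_(e_ i) f x.
  by rewrite [LHS]deriveM.
have cfg : continuous (fun x => f x * g x) by move=> x; exact: cvgM (cf x) (cg x).
have cDfg : continuous (fun x => 'D_(e_ i) (fun x => f x * g x) x).
  rewrite (_ : (fun x => _) = fun x => f x * 'D_(e_ i) g x + g x * 'D_(e_ i) f x).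
    by move=> x; exact: cvgD (cvgM (cf x) (cDg x)) (cvgM (cg x) (cDf x)).
  by apply/funext => x; exact: DE.
have fgK x : ~ K x -> f x * g x = 0 by move=> /gK ->; rewrite mulr0.
have dfg x : derivable (fun x => f x * g x) x (e_ i) by exact: derivableM.
have := Rint_derive0 cfg dfg cDfg cK fgK.
rewrite (@Rint_sub _ _ _ mu setT Omega) => //; last first.
  by move=> x _ Ox; apply: (derive_off (e_ i) (compact_closed (@norm_hausdorff _ _) cK) fgK) => /KO.
under eq_Rintegral do rewrite DE.
rewrite RintegralD//; last 2 first.
- by apply: intble_L1loc_test => //; exact: L1loc_continuous.
- under [X in _.-integrable _ X]eq_fun do rewrite /= mulrC.
  by apply: intble_L1loc_test => //; exact: L1loc_continuous.
move=> /eqP; rewrite addr_eq0 => /eqP ->; congr (- _).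
by apply: eq_Rintegral => x _; rewrite mulrC.
Qed.

(* Successive integrations by parts reverse the order of the derivatives; keeping
   [rev s] spares the symmetry of second derivatives. *)
Lemma Rint_parts s (f g : V -> R) : smooth f -> test_function Omega g ->
  \int[mu]_(x in Omega) (f x * partials s g x) =
  (-1) ^+ size s * \int[mu]_(x in Omega) (partials (rev s) f x * g x).
Proof.
elim: s f => [|i s IH] f sf tg; first by rewrite mul1r.
rewrite [LHS]Rint_parts1//; last exact: test_function_partials.
rewrite IH//; last exact: smooth_derive.
by rewrite rev_cons /partials foldr_rcons /= exprS mulN1r mulNr.
Qed.

Lemma weak_derivative_smooth s (f : V -> R) : smooth f ->
  weak_derivative Omega s f (partials (rev s) f).
Proof.
move=> sf; split.
- exact/L1loc_continuous/smooth_continuous.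
- exact/L1loc_continuous/smooth_continuous/smooth_partials.
- by move=> phi tphi; exact: Rint_parts.
Qed.

Lemma weak_derivativeD s (u u' v v' : V -> R) c :
  weak_derivative Omega s u v -> weak_derivative Omega s u' v' ->
  weak_derivative Omega s (fun x => u x + c * u' x) (fun x => v x + c * v' x).
Proof.
move=> [lu lv H] [lu' lv' H']; split.
- by apply: L1locD => //; exact: L1locZ.
- by apply: L1locD => //; exact: L1locZ.
move=> phi tphi.
have tp := test_function_partials s tphi.
have E (a b p : V -> R) : L1loc Omega a -> L1loc Omega b -> test_function Omega p ->
   \int[mu]_(x in Omega) ((a x + c * b x) * p x) =
   \int[mu]_(x in Omega) (a x * p x) + c * \int[mu]_(x in Omega) (b x * p x).
  move=> la lb tpp; rewrite -RintegralZl//; last exact: intble_L1loc_test.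
  rewrite -RintegralD//; last 2 first.
  - exact: intble_L1loc_test.
  - by apply: intbleZ => //; exact: intble_L1loc_test.
  by apply: eq_Rintegral => x _; rewrite mulrDl mulrA.
by rewrite !E// H// H'// mulrDr mulrCA.
Qed.

Hypothesis bOmega : bounded_set Omega.

Lemma L2P (f : V -> R) : L2 Omega f <-> measurable_fun Omega f /\
  mu.-integrable Omega (EFin \o (fun x => f x ^+ 2)).
Proof.
split=> -[mf If]; split => //.
  apply/integrableP; split; first exact/measurable_EFinP/measurable_funX.
  under eq_integral do rewrite /= normrX.
  exact: If.
move/integrableP : If => [_].
by under eq_integral do rewrite /= normrX.
Qed.

Lemma L2_L1 (f : V -> R) : L2 Omega f -> mu.-integrable Omega (EFin \o f).
Proof.
move=> /L2P[mf If]; apply: (@intble_le _ _ _ _ _ _ (fun x => 1 + f x ^+ 2)) => //.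
  by move=> x _; rewrite -real_normK ?num_real//; have := normr_ge0 (f x); nra.
apply: intbleD => //; apply: (@intble_bounded _ _ _ _ _ _ 1) => //.
  exact: bounded_finite_measure.
by move=> x _; rewrite normr1.
Qed.

Lemma L2D (f g : V -> R) c : L2 Omega f -> L2 Omega g -> L2 Omega (fun x => f x + c * g x).
Proof.
move=> /L2P[mf If] /L2P[mg Ig]; apply/L2P; split.
  by apply: measurable_funD => //; exact: measurable_funM.
apply: (@intble_le _ _ _ _ _ _ (fun x => 2 * f x ^+ 2 + (2 * c ^+ 2) * g x ^+ 2)) => //.
- by apply: measurable_funX; apply: measurable_funD => //; exact: measurable_funM.
- move=> x _; rewrite ger0_norm ?sqr_ge0//.
  by have := sqr_ge0 (f x - c * g x); nra.
- by apply: intbleD => //; exact: intbleZ.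
Qed.

Lemma L2_test (f : V -> R) : test_function Omega f -> L2 Omega f.
Proof.
move=> tf; have [M M0 fM] := test_function_bounded tf.
have mf : measurable_fun Omega f.
  exact: measurable_funS (test_function_measurable tf).
apply/L2P; split => //; apply: (@intble_bounded _ _ _ _ _ _ (M ^+ 2)) => //.
- exact: bounded_finite_measure.
- exact: measurable_funX.
- by move=> x _; rewrite normrX lerXn2r ?nnegrE.
Qed.

Lemma sobolevW2_addtest k (u phi : V -> R) c : sobolevW2 Omega k u ->
  test_function Omega phi -> sobolevW2 Omega k (fun x => u x + c * phi x).
Proof.
move=> [lu H] tphi; split.
  by apply: L1locD => //; apply/L1locZ/L1loc_continuous/smooth_continuous; case: tphi.
move=> s /H[v wv Lv]; exists (fun x => v x + c * partials (rev s) phi x).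
  by apply: weak_derivativeD => //; apply: weak_derivative_smooth; case: tphi.
by apply: L2D => //; apply: L2_test; exact: test_function_partials.
Qed.

(** For the boundary condition, c phi is also added to the approximating test function, which leaves
    the difference, and so its norm, unchanged. *)
Lemma admissible_addtest (u0 u phi : V -> R) c : admissible Omega u0 u ->
  test_function Omega phi -> admissible Omega u0 (fun x => u x + c * phi x).
Proof.
move=> [Wu [W1 H]] tphi; split; first exact: sobolevW2_addtest.
have -> : ((fun x => u x + c * phi x) \- u0)%R = (fun x => (u \- u0)%R x + c * phi x).
  by apply/funext => x /=; rewrite addrAC.
split; first exact: sobolevW2_addtest.
move=> e /H[psi tpsi psie]; exists (fun x => psi x + c * phi x).
  by apply: test_functionD => //; exact: test_functionZ.
rewrite (_ : ((fun x => (u \- u0)%R x + c * phi x) \- _)%R = ((u \- u0) \- psi)%R)//.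
by apply/funext => x /=; ring.
Qed.

End weak_derivatives.

(** * Density of test functions *)

Section density.
Context {R : realType} {n : nat}.
Local Notation V := ('rV[R]_n).
Local Notation mu := (@lebesgue_rV R n).

Lemma elem_measurable (f : V -> R) D : measurable D -> elem f -> measurable_fun D f.
Proof.
move=> mD ef; apply: (@measurable_funS _ _ _ _ setT) => //.
by apply: continuous_measurable_rV; apply: smooth_continuous; exact: elem_smooth.
Qed.

Lemma cvg_bump0 (t : R^nat) : t @ \oo --> +oo -> bump 0 (t k) @[k --> \oo] --> (1 : R).
Proof.
move=> /cvgryPge ty; apply/cvgrPdist_le => e e0.
have : \forall k \near \oo, e^-1 <= t k by exact: ty.
apply: filterS => k ek.
have tk0 : 0 < t k by apply: lt_le_trans ek; rewrite invr_gt0.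
rewrite ger0_norm; last by rewrite subr_ge0; have := bump_le 0 (t k).
rewrite /bump tk0 expr0 mul1r.
have := expR_ge1Dx (- (t k)^-1).
have : (t k)^-1 <= e by rewrite -[e]invrK lef_pV2 ?posrE ?invr_gt0.
lra.
Qed.

Lemma cvg_linear_pinfty (a b : R) : 0 < a -> k%:R * a + b @[k --> \oo] --> +oo.
Proof.
move=> a0; apply/cvgryPge => M; near=> k.
rewrite -lerBlDr -ler_pdivrMr//; near: k.
exact: nbhs_infty_ger.
Unshelve. all: end_near. Qed.

Section weighted.
Context (U : set V) (mU : measurable U) (f : V -> R)
  (If : mu.-integrable U (EFin \o f)).
Local Notation err g h := (\int[mu]_(x in U) (`|f x| * `|g x - h x|)).

Let Iff (g : V -> R) : measurable_fun U g -> (forall x, U x -> `|g x| <= 1) ->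
  mu.-integrable U (EFin \o (fun x => `|f x| * g x)).
Proof.
move=> mg g1; apply: (@intbleM _ _ _ _ _ _ _ 1) => //.
exact: integrable_norm.
Qed.

(** Errors are measured in L^1 with weight |f|, so that integrals of f against the approximants are
    controlled although f is merely integrable; |f| itself is the dominating function. *)
Lemma weighted_cvg (g : (V -> R)^nat) (h : V -> R) :
  (forall k, measurable_fun U (g k)) -> measurable_fun U h ->
  (forall k x, U x -> 0 <= g k x <= 1) -> (forall x, U x -> 0 <= h x <= 1) ->
  (forall x, U x -> g k x @[k --> \oo] --> h x) ->
  forall e, 0 < e -> exists k, err h (g k) <= e.
Proof.
move=> mg mh g01 h01 gh e e0.
have H01 k x : U x -> `|h x - g k x| <= 1.
  by move=> Ux; have := g01 k x Ux; have := h01 x Ux; rewrite ler_norml; lra.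
have mhg k : measurable_fun U (fun x => `|h x - g k x|).
  by apply: measurableT_comp => //; exact: measurable_funB.
have [|||||_ _ H] := @dominated_convergence _ _ _ mu U mU
  (fun k x => (`|f x| * `|h x - g k x|)%:E) (cst 0%E) (fun x => `|f x|%:E).
- move=> k; apply/measurable_EFinP; apply: measurable_funM => //.
  by apply: measurableT_comp => //; exact: intble_measurable If.
- by [].
- apply: aeW => x Ux; apply: cvg_EFin; first exact: nearW.
  rewrite [X in _ --> X](_ : _ = `|f x| * `|h x - h x|); last first.
    by rewrite subrr normr0 mulr0.
  apply: cvgMr; apply: cvg_norm; apply: cvgB; first exact: cvg_cst.
  exact: gh.
- exact: integrable_norm.
- apply: aeW => x k Ux; rewrite lee_fin ger0_norm ?mulr_ge0//.
  by rewrite ler_piMr// H01.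
move: H; rewrite integral0 => /fine_cvgP[_ /cvgrPdist_le/(_ _ e0)].
move=> [k _ /(_ k (leqnn _))]; rewrite sub0r normrN /= => H.
by exists k; apply: le_trans H; exact: ler_norm.
Qed.

(* The sets satisfying [approx] form a sigma-algebra containing the half-spaces. *)
Definition approx (A : set V) := measurable A /\ forall e, 0 < e ->
  exists psi : V -> R, [/\ elem psi, forall x, 0 <= psi x <= 1 &
    err (\1_A) psi <= e].

Let Ierr (g h : V -> R) : measurable_fun U g -> measurable_fun U h ->
  (forall x, U x -> 0 <= g x <= 1) -> (forall x, U x -> 0 <= h x <= 1) ->
  mu.-integrable U (EFin \o (fun x => `|f x| * `|g x - h x|)).
Proof.
move=> mg mh g01 h01; apply: Iff.
  by apply: measurableT_comp => //; exact: measurable_funB.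
move=> x Ux; rewrite normr_id.
by have := g01 x Ux; have := h01 x Ux; rewrite ler_norml; lra.
Qed.

Let ind01 (A : set V) x : 0 <= (\1_A x : R) <= 1.
Proof. by rewrite indicE; case: (_ \in _); rewrite ?lexx ?ler01. Qed.

Let mind (A : set V) : measurable A -> measurable_fun U (\1_A : V -> R).
Proof. by move=> mA; exact: measurable_indic. Qed.

Lemma approxC A : approx A -> approx (~` A).
Proof.
move=> [mA H]; split; first exact: measurableC.
move=> e /H[psi [epsi p01 pe]]; exists (fun x => 1 + - psi x); split.
- by apply: elemD; [exact: elem_cst|exact: elem_opp].
- by move=> x; have := p01 x; lra.
- apply: le_trans pe; rewrite le_eqVlt; apply/orP; left; apply/eqP.
  apply: eq_Rintegral => x _; congr (_ * _).
  rewrite -normrN; congr `|_|.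
  rewrite !indicE in_setC; case: (x \in A) => /=; lra.
Qed.

Lemma approxU A B : approx A -> approx B -> approx (A `|` B).
Proof.
move=> [mA HA] [mB HB]; split; first exact: measurableU.
move=> e e0; have e20 : 0 < e / 2 by rewrite divr_gt0.
have [p [ep p01 pe]] := HA _ e20; have [q [eq q01 qe]] := HB _ e20.
(* This is 1 - (1 - p) (1 - q): it stays in [0, 1], is 1-Lipschitz in each argument there, and on
   indicators gives the union. *)
exists (fun x => p x + (q x + - (p x * q x))); split.
- by apply: elemD => //; apply: elemD => //; apply: elem_opp; exact: elemM.
- by move=> x; have := p01 x; have := q01 x; nra.
rewrite [e]splitr; apply: le_trans (lerD pe qe).
have mp := elem_measurable mU ep; have mq := elem_measurable mU eq.
rewrite -RintegralD//; try by apply: Ierr => //; exact: mind.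
apply: le_Rintegral => //.
- apply: Ierr => //.
  + by apply: mind; exact: measurableU.
  + apply: measurable_funD => //; apply: measurable_funB => //.
    exact: measurable_funM.
  + by move=> x _; have := p01 x; have := q01 x; nra.
- by apply: intbleD => //; apply: Ierr => //; exact: mind.
move=> x _; rewrite -mulrDr ler_wpM2l//.
have Hn (y : R) : - `|y| <= y <= `|y| by rewrite -ler_norml.
have := p01 x; have := q01 x; rewrite !indicE in_setU.
set a := `|_ - p x|; set b := `|_ - q x|.
have /andP[a1 a2] : - a <= (x \in A)%:R - p x <= a := Hn _.
have /andP[b1 b2] : - b <= (x \in B)%:R - q x <= b := Hn _.
move: a b a1 a2 b1 b2 => a b.
by case: (x \in A); case: (x \in B) => /= ? ? ? ? /andP[? ?] /andP[? ?];
  rewrite ler_norml; apply/andP; split; nra.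
Qed.

Lemma approx0 : approx set0.
Proof.
split=> // e e0; exists (fun=> 0); split; [exact: elem_cst|by move=> _; rewrite lexx ler01|].
rewrite (_ : (fun x => _) = cst 0); first by rewrite Rintegral_cst// mul0r ltW.
by apply/funext => x; rewrite indicE in_set0 subrr normr0 mulr0.
Qed.

Lemma approx_bigcup (F : (set V)^nat) : (forall k, approx (F k)) ->
  approx (\bigcup_k F k).
Proof.
move=> HF; split; first by apply: bigcup_measurable => k _; have [] := HF k.
have aN N : approx (\bigcup_(k < N) F k).
  elim: N => [|N IH].
    by rewrite (_ : \bigcup_(k < 0) _ = set0) ?II0 ?bigcup_set0//; exact: approx0.
  by rewrite bigcup_mkord big_ord_recr -bigcup_mkord; exact: approxU.
move=> e e0; have e20 : 0 < e / 2 by rewrite divr_gt0.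
have mF N : measurable (\bigcup_(k < N) F k) by have [] := aN N.
have mUF : measurable (\bigcup_k F k).
  by apply: bigcup_measurable => k _; have [] := HF k.
have cvgF x : U x -> (\1_(\bigcup_(k < N) F k) x : R) @[N --> \oo] --> (\1_(\bigcup_k F k) x : R).
  move=> _; have [[k _ Fkx]|nF] := pselect ((\bigcup_k F k) x).
    rewrite [X in _ --> X]indicE mem_set; last by exists k.
    apply: cvg_near_cst; exists k.+1 => // N /= kN.
    by rewrite indicE mem_set//; exists k.
  rewrite [X in _ --> X]indicE memNset//.
  apply: cvg_near_cst; apply: nearW => N; rewrite indicE memNset// => -[k _ Fk].
  by apply: nF; exists k.
have [N HN] := @weighted_cvg (fun N => \1_(\bigcup_(k < N) F k)) (\1_(\bigcup_k F k))
  (fun N => mind (mF N)) (mind mUF) (fun N x _ => ind01 _ x) (fun x _ => ind01 _ x)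
  cvgF _ e20.
have [_ /(_ _ e20)[psi [epsi p01 pe]]] := aN N.
exists psi; split => //; rewrite [e]splitr; apply: le_trans (lerD HN pe).
have mp := elem_measurable mU epsi.
rewrite -RintegralD//; try by apply: Ierr => //; exact: mind.
apply: le_Rintegral => //.
- by apply: Ierr => //; exact: mind.
- by apply: intbleD => //; apply: Ierr => //; exact: mind.
by move=> x _; rewrite -mulrDr ler_wpM2l// ler_distD.
Qed.

Lemma approx_gt i (a : R) : approx [set x : V | a < x ord0 i].
Proof.
have mA : measurable [set x : V | a < x ord0 i].
  rewrite [X in measurable X](_ : _ = (fun x : V => x ord0 i) @^-1` `]a, +oo[%classic).
    by rewrite -[X in measurable X]setTI; exact: measurable_coor.
  by apply/funext => x /=; rewrite in_itv/= andbT.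
split=> // e e0.
(* As k grows this tends to 1 on the open half-space, and it is identically 0 off it. *)
pose g (k : nat) (x : V) := bump 0 (k%:R * (x ord0 i + - a)).
have eg k : elem (g k).
  apply: elem_bump; apply: elemM; first exact: elem_cst.
  by apply: elemD; [exact: elem_coor|exact: elem_cst].
have g01 k x : 0 <= g k x <= 1 by rewrite bump_ge0 bump_le.
have cvgg x : U x -> g k x @[k --> \oo] --> (\1_[set x : V | a < x ord0 i] x : R).
  move=> _; rewrite indicE; have [ax|ax] := pselect (a < x ord0 i).
    rewrite mem_set//; apply: cvg_bump0.
    under eq_fun do rewrite -[_ * _]addr0.
    by apply: cvg_linear_pinfty; rewrite subr_gt0.
  rewrite memNset//; apply: cvg_near_cst; apply: nearW => k.
  rewrite /g bump_npos// mulr_ge0_le0// subr_le0 leNgt; exact/negP.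
have [k Hk] := @weighted_cvg g _ (fun k => elem_measurable mU (eg k)) (mind mA)
  (fun k x _ => g01 k x) (fun x _ => ind01 _ x) cvgg e e0.
by exists (g k).
Qed.

Lemma approx_measurable A : measurable A -> approx A.
Proof.
move=> mA; suff : g_sigma_preimage (fun (i : 'I_n) (x : V) => x ord0 i) `<=` approx by apply.
have sapprox : sigma_algebra setT approx.
  split; first exact: approx0.
  - by move=> B aB; rewrite setTD; exact: approxC.
  - exact: approx_bigcup.
apply: smallest_sub => //.
rewrite -bigcup_seq => B [i _ [C mC <-]] /=; rewrite setTI.
have : (RGenOInfty.G (R:=R)).-sigma.-measurable C by rewrite -RGenOInfty.measurableE.
(* A second generation argument, now for the Borel sets of the line, reduces to open rays and hence
   to half-spaces. *)
suff : (RGenOInfty.G (R:=R)).-sigma.-measurable `<=`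
    [set D | approx ((fun x : V => x ord0 i) @^-1` D)] by apply.
apply: smallest_sub.
  split => /=.
  - by rewrite preimage_set0; exact: approx0.
  - by move=> D aD; rewrite setTD preimage_setC; exact: approxC.
  - by move=> F aF; rewrite preimage_bigcup; exact: approx_bigcup.
move=> _ [a ->] /=; rewrite [X in approx X](_ : _ = [set x : V | a < x ord0 i]).
  exact: approx_gt.
by apply/funext => x /=; rewrite in_itv/= andbT.
Qed.

End weighted.

Section ball_cutoff.
Context (x0 : V) (r : R) (r0 : 0 < r).

(* Balls are those of the sup norm; [ball_fun] is positive exactly on the ball, and
   the cutoffs are supported in the compact sets [1 / k <= ball_fun]. *)
Definition ball_fun (x : V) : R :=
  \prod_(i < n) bump 0 (r ^+ 2 + - ((x ord0 i + - x0 ord0 i) * (x ord0 i + - x0 ord0 i))).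

Lemma elem_prod (s : seq 'I_n) (F : 'I_n -> V -> R) : (forall i, elem (F i)) ->
  elem (fun x => \prod_(i <- s) F i x).
Proof.
move=> H; elim: s => [|i s IH].
  under eq_fun do rewrite big_nil.
  exact: elem_cst.
under eq_fun do rewrite big_cons.
exact: elemM.
Qed.

Lemma elem_ball_fun : elem ball_fun.
Proof.
apply: elem_prod => i; apply: elem_bump; apply: elemD; first exact: elem_cst.
by apply: elem_opp; apply: elemM; apply: elemD; (exact: elem_coor || exact: elem_cst).
Qed.

Lemma ball_fun_gt0 x : 0 < ball_fun x <-> ball x0 r x.
Proof.
have H i : (0 < r ^+ 2 + - ((x ord0 i + - x0 ord0 i) * (x ord0 i + - x0 ord0 i))) =
    (`|x0 ord0 i - x ord0 i| < r).
  rewrite subr_gt0 -expr2 distrC -[X in X < _]real_normK ?num_real//.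
  by rewrite ltr_pXn2r ?nnegrE// ltW.
split=> [h|/rV_ballP[_ h]]; last first.
  by apply: prodr_gt0 => i _; apply: bump_gt0; rewrite H.
apply/rV_ballP; split => // i; rewrite -H ltNge; apply/negP => h0; move: h.
by rewrite /ball_fun (bigD1 i)//= bump_npos// mul0r ltxx.
Qed.

Definition ball_cutoff (k : nat) (x : V) : R := bump 0 (k%:R * ball_fun x + - 1).

Lemma elem_ball_cutoff k : elem (ball_cutoff k).
Proof.
apply: elem_bump; apply: elemD; last exact: elem_cst.
by apply: elemM; [exact: elem_cst|exact: elem_ball_fun].
Qed.

Lemma test_cutoffM k (psi : V -> R) : elem psi ->
  test_function (ball x0 r) (fun x => psi x * ball_cutoff k x).
Proof.
move=> ep; split; first by apply: elem_smooth; apply: elemM => //; exact: elem_ball_cutoff.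
exists [set x | 1 <= k%:R * ball_fun x]; split.
- apply: bounded_closed_compact.
    exists (`|x0| + r); split; first exact: num_real.
    move=> M hM x /= h; apply: le_trans (ltW hM).
    have /rV_ballE : ball x0 r x.
      apply/ball_fun_gt0; rewrite ltNge; apply/negP => b0.
      by have : (k%:R : R) * ball_fun x <= 0; [exact: mulr_ge0_le0|lra].
    have := ler_normB x0 (x0 - x); rewrite subKr; lra.
  rewrite [X in closed X](_ : _ = (fun x => k%:R * ball_fun x) @^-1` [set t | 1 <= t])//.
  apply: preimage_closed; last exact: closed_ge.
  move=> x _; apply: smooth_continuous; apply: elem_smooth.
  by apply: elemM; [exact: elem_cst|exact: elem_ball_fun].
- move=> x /= h; apply/ball_fun_gt0; rewrite ltNge; apply/negP => b0.
  by have : (k%:R : R) * ball_fun x <= 0; [exact: mulr_ge0_le0|lra].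
- move=> x /= /negP; rewrite -ltNge => h.
  by rewrite /ball_cutoff bump_npos ?mulr0// subr_le0 ltW.
Qed.

Lemma density (f : V -> R) (A : set V) (e : R) :
  mu.-integrable (ball x0 r) (EFin \o f) -> measurable A -> 0 < e ->
  exists psi : V -> R, [/\ elem psi, test_function (ball x0 r) psi,
    forall x, 0 <= psi x <= 1 &
    \int[mu]_(x in ball x0 r) (`|f x| * `|\1_A x - psi x|) <= e].
Proof.
move=> If mA e0; have mU := measurable_ball_rV x0 r.
have e20 : 0 < e / 2 by rewrite divr_gt0.
have [_ /(_ _ e20)[psi [epsi p01 pe]]] := approx_measurable mU If mA.
have c01 k x : 0 <= ball_cutoff k x <= 1 by rewrite bump_ge0 bump_le.
have cvgc x : ball x0 r x -> ball_cutoff k x @[k --> \oo] --> (1 : R).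
  move=> /ball_fun_gt0 h; apply: cvg_bump0; exact: cvg_linear_pinfty.
have [k Hk] := @weighted_cvg _ mU _ If ball_cutoff (cst 1)
  (fun k => elem_measurable mU (elem_ball_cutoff k)) (@measurable_cst _ _ _ _ _ _)
  (fun k x _ => c01 k x) (fun x _ => (introT andP (conj ler01 (lexx 1)))) cvgc _ e20.
(* The first factor approximates the indicator; the second supplies the compact support and
   approximates 1 on the ball. *)
exists (fun x => psi x * ball_cutoff k x); split.
- by apply: elemM => //; exact: elem_ball_cutoff.
- exact: test_cutoffM.
- by move=> x; have := p01 x; have := c01 k x; nra.
have mp := elem_measurable mU epsi.
have mc := elem_measurable mU (elem_ball_cutoff k).
have mI : measurable_fun (ball x0 r) (\1_A : V -> R) by exact: measurable_indic.
have i01 x : 0 <= (\1_A x : R) <= 1.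
  by rewrite indicE; case: (_ \in _); rewrite ?lexx ?ler01.
have Inn := integrable_norm If.
have II (g h : V -> R) : measurable_fun (ball x0 r) g -> measurable_fun (ball x0 r) h ->
    (forall x, 0 <= g x <= 1) -> (forall x, 0 <= h x <= 1) ->
    mu.-integrable (ball x0 r) (EFin \o (fun x => `|f x| * `|g x - h x|)).
  move=> mg mh g01 h01; apply: (@intbleM _ _ _ _ _ _ _ 1) => //.
    by apply: measurableT_comp => //; exact: measurable_funB.
  move=> x Ux; rewrite normr_id.
  by have := g01 x; have := h01 x; rewrite ler_norml; lra.
rewrite [e]splitr; apply: le_trans (lerD pe Hk).
have o01 (x : V) : 0 <= (cst 1 x : R) <= 1 by rewrite /cst lexx ler01.
rewrite -RintegralD//; try exact: II.
apply: le_Rintegral => //.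
- apply: II => //; first exact: measurable_funM.
  by move=> x; have := p01 x; have := c01 k x; nra.
- by apply: intbleD => //; exact: II.
move=> x _; rewrite -mulrDr ler_wpM2l//.
apply: le_trans (ler_distD (psi x) _ _) _; rewrite lerD2l.
rewrite -[X in X - _]mulr1 -mulrBr normrM ler_piMl//.
by have := p01 x; rewrite ler_norml; lra.
Qed.

End ball_cutoff.
End density.

(** * The fundamental lemma of the calculus of variations *)

Section fundamental_lemma.
Context {R : realType} {n : nat}.
Local Notation V := ('rV[R]_n).
Local Notation mu := (@lebesgue_rV R n).

(** By density the hypothesis extends from test functions to indicators. The set where f >= 0 and
    its complement each contribute at most C, hence the factor 2. *)
Lemma Rint_normr_le_test (x0 : V) (r : R) (f : V -> R) (C : R) : 0 < r ->
  mu.-integrable (ball x0 r) (EFin \o f) ->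
  (forall psi, elem psi -> test_function (ball x0 r) psi -> (forall x, 0 <= psi x <= 1) ->
    `|\int[mu]_(x in ball x0 r) (f x * psi x)| <= C) ->
  \int[mu]_(x in ball x0 r) `|f x| <= 2 * C.
Proof.
move=> r0 If fC; set U := ball x0 r; have mU : measurable U := measurable_ball_rV x0 r.
have mf := intble_measurable If.
have IfM (h : V -> R) : measurable_fun U h -> (forall x, `|h x| <= 1) ->
    mu.-integrable U (EFin \o (fun x => f x * h x)).
  by move=> mh h1; apply: (@intbleM _ _ _ _ _ _ _ 1).
have mI (A : set V) : measurable A -> measurable_fun U (\1_A : V -> R).
  by move=> mA; exact: measurable_indic.
have I1 (A : set V) x : `|\1_A x : R| <= 1.
  by rewrite indicE; case: (_ \in _); rewrite ?normr1 ?normr0.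
have HA (A : set V) : measurable A -> `|\int[mu]_(x in U) (f x * \1_A x)| <= C.
  move=> mA; apply/ler_addgt0Pr => e e0.
  have [psi [epsi tpsi psi01 psie]] := density r0 If mA e0.
  have mpsi : measurable_fun U psi.
    exact: measurable_funS (test_function_measurable tpsi).
  have psi1 x : `|psi x| <= 1 by have := psi01 x; rewrite ler_norml; lra.
  have -> : \int[mu]_(x in U) (f x * \1_A x) =
      \int[mu]_(x in U) (f x * psi x) + \int[mu]_(x in U) (f x * (\1_A x - psi x)).
    rewrite -RintegralD//; [|exact: IfM|].
      by apply: eq_Rintegral => x _; ring.
    apply: IfM; first exact: measurable_funB (mI _ mA) mpsi.
    move=> x; have := psi01 x; rewrite ler_norml indicE.
    by case: (_ \in _) => /=; lra.
  apply: le_trans (ler_normD _ _) _; apply: lerD; first exact: fC.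
  apply: le_trans psie; apply: Rint_norm_le => //.
  - by apply: measurable_funM => //; exact: measurable_funB (mI _ mA) mpsi.
  - apply: (@intbleM _ _ _ _ _ _ _ 1) => //; first exact: integrable_norm.
      by apply: measurableT_comp => //; exact: measurable_funB (mI _ mA) mpsi.
    move=> x _; have := psi01 x; rewrite normr_id ler_norml indicE.
    by case: (_ \in _) => /=; lra.
  - by move=> x _; rewrite normrM.
pose A := U `&` f @^-1` `[0, +oo[%classic.
have mA : measurable A by exact: mf.
have -> : \int[mu]_(x in U) `|f x| =
    \int[mu]_(x in U) (f x * \1_A x) - \int[mu]_(x in U) (f x * \1_(~` A) x).
  rewrite -RintegralB//; [|exact: IfM (mI _ mA) _|].
    apply: eq_Rintegral => x; rewrite inE => Ux; rewrite !indicE in_setC.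
    have [f0|f0] := leP 0 (f x).
      have xA : A x by split => //=; rewrite in_itv/= f0.
      by rewrite mem_set//= mulr1 mulr0 subr0 ger0_norm.
    have xA : ~ A x by move=> [_]/=; rewrite in_itv/= leNgt f0.
    by rewrite memNset//= mulr1 mulr0 sub0r ltr0_norm.
  by apply: IfM => //; apply: mI; exact: measurableC.
have := HA _ mA; have := HA _ (measurableC mA); rewrite !ler_norml; lra.
Qed.

(** On a ball whose double lies in Omega, f is integrable and [Rint_normr_le_test] applies with C =
    0; countably many such balls cover Omega. *)
Lemma fundamental_lemma (Omega : set V) (f : V -> R) : open Omega -> L1loc Omega f ->
  (forall phi, test_function Omega phi -> \int[mu]_(x in Omega) (f x * phi x) = 0) ->
  ae_eq mu Omega f (cst 0).
Proof.
move=> oO [mf If] H; have mO := open_measurable_rV oO.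
have Hball (x0 : V) (r : R) : 0 < r -> ball x0 (2 * r) `<=` Omega ->
    ae_eq mu (ball x0 r) f (cst 0).
  move=> r0 BO; set U := ball x0 r; have mU : measurable U := measurable_ball_rV x0 r.
  pose K := [set y : V | `|x0 - y| <= r].
  have UK : U `<=` K by move=> y /rV_ballE/ltW.
  have KO : K `<=` Omega by move=> y; rewrite /K/= => h; apply: BO; apply/rV_ballE; lra.
  have cK : compact K by exact: compact_le_ball.
  have mK := compact_measurable_rV cK.
  have IU : mu.-integrable U (EFin \o f) by apply: (@intbleS _ _ _ _ K) => //; exact: If.
  have I0 : \int[mu]_(x in U) `|f x| = 0.
    apply/eqP; rewrite eq_le; apply/andP; split; last exact: Rintegral_ge0.
    rewrite -(mulr0 2); apply: Rint_normr_le_test => // psi _ tpsi _.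
    rewrite -(@Rint_sub _ _ _ mu Omega U).
    - by rewrite H ?normr0//; apply: test_functionS tpsi => y /UK /KO.
    - by move=> y /UK /KO.
    - move=> x _ Ux; have [_ [L [_ LU Lpsi]]] := tpsi.
      by rewrite Lpsi ?mulr0// => /LU.
  have := @ae_eq_integral_abs _ _ _ mu U mU (EFin \o f).
  case=> [|h _]; first by case/integrableP : IU.
  have : ae_eq mu U (EFin \o f) (cst 0%E).
    apply: h; have := Rint_EFin mU (integrable_norm IU).
    by rewrite I0 => <-.
  by apply: filterS => x h' Ux; have := h' Ux => /= -[].
rewrite /ae_eq (open_bigcup_ball_rV oO).
set P := [set q | _].
(* The exceptional sets are reindexed by natural numbers through the countable encoding of the pairs
   (rational center, radius). *)
pose F (k : nat) : set V := if unpickle k is Some q then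
   (if q \in P then
   ball (map_mx ratr q.1 : 'rV[R]_n) (q.2.+1%:R^-1) `&` [set x | f x != 0] else set0) else set0.
have : mu.-negligible (\bigcup_k F k).
  apply: negligible_bigcup => k; rewrite /F; case: (unpickle k) => [q|];
    last exact: negligible_set0.
  case: ifPn => [|_]; last exact: negligible_set0.
  rewrite inE => Pq.
  have q0 : 0 < q.2.+1%:R^-1 :> R by rewrite invr_gt0.
  have := Hball _ _ q0 Pq; apply: negligibleS => x [/= Bx fx] /(_ Bx) fx0.
  by rewrite fx0 eqxx in fx.
apply: negligibleS => x /= /existsNP[h] /eqP fx.
case: h => q Pq Bq; exists (pickle q) => //; by rewrite /F pickleK mem_set.
Qed.

Lemma weak_derivative_unique (Omega : set V) s (u v w : V -> R) : open Omega ->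
  weak_derivative Omega s u v -> weak_derivative Omega s u w -> ae_eq mu Omega v w.
Proof.
move=> oO [lu lv Hv] [_ lw Hw].
have lvw : L1loc Omega (fun x => v x + (-1) * w x) by apply: L1locD => //; exact: L1locZ.
have : ae_eq mu Omega (fun x => v x + (-1) * w x) (cst 0).
  have mO := open_measurable_rV oO.
  apply: fundamental_lemma => // phi tphi.
  have : \int[mu]_(x in Omega) (v x * phi x) = \int[mu]_(x in Omega) (w x * phi x).
    have := Hv _ tphi; rewrite (Hw _ tphi) => /(congr1 ( *%R ((-1) ^+ size s))).
    by rewrite !mulrA -expr2 sqrr_sign !mul1r.
  move=> E; under eq_Rintegral do rewrite mulN1r mulrBl.
  by rewrite RintegralB// ?E ?subrr//; exact: intble_L1loc_test.
by apply: filterS => x h Ox; have /eqP := h Ox; rewrite mulN1r subr_eq0 => /eqP.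
Qed.

End fundamental_lemma.

(** * The inequality satisfied by the Laplacian of a minimizer *)

Section minimality.
Context {R : realType} {n : nat}.
Local Notation V := ('rV[R]_n).
Local Notation mu := (@lebesgue_rV R n).

Definition lap (phi : V -> R) (x : V) : R := \sum_(i < n) partials [:: i; i] phi x.

Lemma test_function_lap D (phi : V -> R) : test_function D phi -> test_function D (lap phi).
Proof.
move=> tphi; apply: test_function_sum => i.
exact: (@test_function_partials _ _ D [:: i; i] phi).
Qed.

Context (Omega : set V) (oO : open Omega) (bO : bounded_set Omega).
Let mO : measurable Omega. Proof. exact: open_measurable_rV. Qed.

(** [wderiv] is an arbitrary choice and may differ from the square-integrable derivative given by
    [sobolevW2]; uniqueness almost everywhere transfers the integrability. *)
Lemma wderivP k s (u : V -> R) : sobolevW2 Omega k u -> (size s <= k)%N ->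
  weak_derivative Omega s u (wderiv Omega s u) /\ L2 Omega (wderiv Omega s u).
Proof.
move=> [_ H] /H[v wv Lv].
have ww : weak_derivative Omega s u (wderiv Omega s u) by apply: (getPex (ex_intro _ v wv)).
split => //; have [_ [mw _] _] := ww; split => //.
have [mv Iv] := Lv; apply: le_lt_trans Iv.
rewrite (@ae_eq_integral _ _ _ mu Omega (fun x => (`|v x| ^+ 2)%:E)) //.
- by apply/measurable_EFinP; apply: measurable_funX; exact: measurableT_comp.
- by apply/measurable_EFinP; apply: measurable_funX; exact: measurableT_comp.
- by have := weak_derivative_unique oO ww wv; apply: filterS => x h Ox; rewrite h.
Qed.

Lemma laplacian_L2 (u : V -> R) : sobolevW2 Omega 2 u -> L2 Omega (laplacian Omega u).
Proof.
move=> Wu; rewrite /laplacian; elim: (index_enum _) => [|i s IH].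
  under eq_fun do rewrite big_nil.
  apply: L2_test => //; split; first exact: elem_smooth (elem_cst 0).
  by exists set0; split => //; exact: compact0.
under eq_fun do rewrite big_cons addrC -[X in _ + X]mul1r.
by apply: L2D => //; case: (wderivP Wu (s := [:: i; i]) isT).
Qed.

Lemma ae_eq_sum (I : Type) (s : seq I) (F G : I -> V -> R) :
  (forall i, ae_eq mu Omega (F i) (G i)) ->
  ae_eq mu Omega (fun x => \sum_(i <- s) F i x) (fun x => \sum_(i <- s) G i x).
Proof.
move=> H; elim: s => [|i s IH].
  by apply: aeW => x _; rewrite !big_nil.
move: (H i) IH; apply: filterS2 => x h1 h2 Ox.
by rewrite !big_cons h1// h2.
Qed.

Lemma laplacian_addtest (u phi : V -> R) t : sobolevW2 Omega 2 u ->
  test_function Omega phi ->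
  ae_eq mu Omega (laplacian Omega (fun x => u x + t * phi x))
    (fun x => laplacian Omega u x + t * lap phi x).
Proof.
move=> Wu tphi.
rewrite (_ : (fun x => _ + t * lap phi x) = fun x => \sum_(i < n)
   (wderiv Omega [:: i; i] u x + t * partials [:: i; i] phi x)); last first.
  by apply/funext => x; rewrite big_split/= -mulr_sumr.
apply: ae_eq_sum => i.
have [ww _] := wderivP Wu (s := [:: i; i]) isT.
have [ww' _] := wderivP (sobolevW2_addtest oO bO t Wu tphi) (s := [:: i; i]) isT.
apply: (weak_derivative_unique oO ww').
have := weak_derivative_smooth oO [:: i; i] tphi.1.
(* The list of two equal directions is its own reversal, so the weak derivative of phi is the
   expected second partial. *)
rewrite -[rev _]/[:: i; i] => wphi.
by have := weak_derivativeD oO t ww wphi.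
Qed.

Definition energy_density (g u : V -> R) (x : V) : R := g x ^+ 2 + \1_[set y | 0 < u y] x.

Lemma intble_energy (g u : V -> R) : L2 Omega g -> measurable_fun Omega u ->
  mu.-integrable Omega (EFin \o energy_density g u).
Proof.
move=> /L2P[mg Ig] mu_; apply: intbleD => //.
(* Measurability of u is known on Omega only, so the positivity set is cut down to Omega first. *)
have mA : measurable (Omega `&` [set y | 0 < u y]).
  rewrite [X in _ `&` X](_ : _ = u @^-1` `]0, +oo[%classic); first exact: mu_.
  by apply/funext => x /=; rewrite in_itv/= andbT.
apply: (@eq_integrable _ _ _ mu Omega mO (EFin \o (\1_(Omega `&` [set y | 0 < u y]) : V -> R))).
  by move=> x; rewrite inE => Ox /=; rewrite !indicE in_setI mem_set.
apply: (@intble_bounded _ _ _ _ _ _ 1) => //.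
- exact: bounded_finite_measure.
- by move=> x _; rewrite indicE; case: (_ \in _); rewrite ?normr1 ?normr0.
Qed.

Lemma JE (u g : V -> R) : sobolevW2 Omega 2 u -> ae_eq mu Omega (laplacian Omega u) g ->
  L2 Omega g -> J Omega u = (\int[mu]_(x in Omega) energy_density g u x)%:E.
Proof.
move=> Wu ug Lg; have mu_ : measurable_fun Omega u by case: Wu => -[].
have Lu := laplacian_L2 Wu.
rewrite Rint_EFin//; last exact: intble_energy.
rewrite /J; apply: ae_eq_integral => //.
- have := measurable_int _ (intble_energy Lu mu_); apply: eq_measurable_fun => x _.
  by rewrite /= /energy_density -normrX ger0_norm ?sqr_ge0.
- exact: (measurable_int _ (intble_energy Lg mu_)).
- apply: filterS ug => x h Ox; rewrite /energy_density h//.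
  by rewrite -normrX ger0_norm ?sqr_ge0.
Qed.

Context (u0 u : V -> R) (umin : minimizer Omega u0 u).

(* Compare u with u + t phi for t = 1/M and t = -1/M: the characteristic functions
   of the two positivity sets differ only inside U. *)
Lemma key_inequality (U : set V) (phi : V -> R) (M : R) : measurable U ->
  U `<=` Omega -> test_function U phi -> 0 < M -> (forall x, `|lap phi x| <= M) ->
  `|\int[mu]_(x in Omega) (laplacian Omega u x * lap phi x)| <= M * fine (mu U).
Proof.
move=> mU UO tphiU M0 lM.
have tphi : test_function Omega phi := test_functionS UO tphiU.
have [[Wu W1] Jmin] := umin.
have Lg := laplacian_L2 Wu; set g := laplacian Omega u in Lg *.
have tl := test_function_lap tphi; have Ll := L2_test oO bO tl.
have Ufin : (mu U < +oo)%E.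
  apply: (@le_lt_trans _ _ (mu Omega)); last exact: bounded_finite_measure.
  by apply: le_measure => //; rewrite inE.
have off x : ~ U x -> phi x = 0 /\ lap phi x = 0.
  move=> Ux; have [_ [K [_ KU ->]]] := tphiU; last by move=> /KU.
  by have [_ [L [_ LU ->]]] := test_function_lap tphiU => // /LU.
have IUO : mu.-integrable Omega (EFin \o (\1_U : V -> R)).
  apply: (@intbleS _ _ _ _ setT) => //; apply: (@intble_sub _ _ _ _ _ U) => //.
    by move=> x _ Ux; rewrite indicE memNset.
  apply: (@intble_bounded _ _ _ _ _ _ 1) => //.
  by move=> x _; rewrite indicE; case: (_ \in _); rewrite ?normr1 ?normr0.
have Igl : mu.-integrable Omega (EFin \o (fun x => g x * lap phi x)).
  apply: intble_L1loc_test => //; split=> [|K cK KO]; first by case: Lg.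
  apply: (@intbleS _ _ _ _ Omega) => //; first exact: compact_measurable_rV.
  exact: L2_L1.
have IU : \int[mu]_(x in Omega) \1_U x = fine (mu U).
  rewrite (@Rint_sub _ _ _ mu Omega U)//; last by move=> x _ Ux; rewrite indicE memNset.
  rewrite -[RHS]mul1r -Rintegral_cst//; apply: eq_Rintegral => x.
  by rewrite indicE => ->.
(* On U the energy density grows by at most 2 t g lap(phi) + t^2 M^2 + 1, where the 1 bounds the
   jump of the characteristic function; off U it does not change. *)
have main t : 0 <= 2 * t * \int[mu]_(x in Omega) (g x * lap phi x)
    + (t ^+ 2 * M ^+ 2 + 1) * fine (mu U).
  have Wt := sobolevW2_addtest oO bO t Wu tphi.
  have Lt := L2D oO t Lg Ll.
  have := Jmin _ (admissible_addtest oO bO t (conj Wu W1) tphi).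
  rewrite (JE Wu (ae_eq_refl _ _ _) Lg) (JE Wt (laplacian_addtest t Wu tphi) Lt) lee_fin.
  set v := fun x => u x + t * phi x.
  have mu_ : measurable_fun Omega u by case: Wu => -[].
  have mv : measurable_fun Omega v by case: Wt => -[].
  move=> h.
  have Iu := intble_energy Lg mu_.
  have Iq : mu.-integrable Omega (EFin \o (fun x => 2 * t * (g x * lap phi x)
     + (t ^+ 2 * M ^+ 2 + 1) * \1_U x)).
    by apply: intbleD => //; exact: intbleZ.
  suff : \int[mu]_(x in Omega) energy_density (fun x => g x + t * lap phi x) v x <=
     \int[mu]_(x in Omega) (energy_density g u x + (2 * t * (g x * lap phi x)
     + (t ^+ 2 * M ^+ 2 + 1) * \1_U x)).
    rewrite [in X in _ <= X -> _]RintegralD//.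
    rewrite [X in _ <= _ + X -> _]RintegralD//; [|exact: intbleZ|exact: intbleZ].
    by rewrite !RintegralZl// IU; lra.
  apply: le_Rintegral => //; [exact: intble_energy|exact: intbleD|].
  move=> x Ox; rewrite /energy_density; have [Ux|Ux] := pselect (U x).
    have := lM x; rewrite ler_norml => /andP[l1 l2].
    have l3 : lap phi x ^+ 2 <= M ^+ 2 by nra.
    have l4 : t ^+ 2 * lap phi x ^+ 2 <= t ^+ 2 * M ^+ 2 by rewrite ler_wpM2l ?sqr_ge0.
    have i1 (A : set V) : 0 <= (\1_A x : R) <= 1.
      by rewrite indicE; case: (_ \in _); rewrite ?lexx ?ler01.
    rewrite [\1_U x]indicE mem_set// mulr1.
    by have := i1 [set y | 0 < u y]; have := i1 [set y | 0 < v y]; nra.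
  have [p0 q0] := off x Ux.
  rewrite q0 !mulr0 [\1_U x]indicE memNset// mulr0 !addr0 lerD2l !indicE.
  rewrite (_ : (x \in [set y | 0 < v y]) = (x \in [set y | 0 < u y]))//.
  by apply/idP/idP; rewrite !inE/= /v p0 mulr0 addr0.
(* At |t| = 1/M the quadratic term and the jump term both contribute exactly |U|; dividing 2 |U| by
   2 |t| leaves M |U|. *)
have M1 : M^-1 ^+ 2 * M ^+ 2 = 1 by rewrite -exprMn mulVf ?expr1n// gt_eqF.
have h1 := main (M^-1); have h2 := main (- M^-1).
rewrite sqrrN M1 in h2; rewrite M1 in h1.
set I := Rintegral _ _ _ in h1 h2 *; set W := fine _ in h1 h2 *.
have MV : M * M^-1 = 1 by rewrite mulfV// gt_eqF.
rewrite ler_norml; apply/andP; split.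
  have : 0 <= M * (2 * M^-1 * I + (1 + 1) * W) by rewrite mulr_ge0// ltW.
  have -> : M * (2 * M^-1 * I + (1 + 1) * W) = 2 * (M * M^-1) * I + 2 * (M * W) by ring.
  rewrite MV; lra.
have : 0 <= M * (2 * - M^-1 * I + (1 + 1) * W) by rewrite mulr_ge0// ltW.
have -> : M * (2 * - M^-1 * I + (1 + 1) * W) = 2 * (M * W) - 2 * (M * M^-1) * I by ring.
rewrite MV; lra.
Qed.

End minimality.

(** * Radial kernels *)

Section kernels.
Context {R : realType} {n : nat}.
Local Notation V := ('rV[R]_n).
Local Notation e_ i := (delta_mx ord0 i : V).
Implicit Types (x y : V) (l : R).

Definition sqdist y x : R := \sum_(i < n) (x ord0 i + - y ord0 i) * (x ord0 i + - y ord0 i).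

(* [l] is the inverse of the radius: [kernel y l] and [potential y l] are supported in
   the closed Euclidean ball of center [y] and radius [1 / l], and the total mass of
   [kernel y l] does not depend on [l]. *)
Definition potential y l x : R := bump 0 (1 + - (l ^+ 2 * sqdist y x)).

Definition kernel y l x : R := mono_bump n 0 2 (sqdist y x) l.

(** The derivative of [kernel y l x] in l, read off from [is_derive_mono_bump] at exponents n, 0 and
    bump index 2. *)
Definition dkernel y l x : R :=
  n%:R * mono_bump n.-1 0 2 (sqdist y x) l - 2 * mono_bump n.+1 1 4 (sqdist y x) l
  + 4 * mono_bump n.+1 1 3 (sqdist y x) l.

Lemma sqdist_ge0 y x : 0 <= sqdist y x.
Proof. by apply: sumr_ge0 => i _; rewrite -expr2 sqr_ge0. Qed.

Lemma elem_sqdist y : elem (sqdist y).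
Proof.
apply: elem_sum => i _.
by apply: elemM; apply: elemD; (exact: elem_coor || exact: elem_cst).
Qed.

Lemma elem_potential y l : elem (potential y l).
Proof.
apply: elem_bump; apply: elemD; first exact: elem_cst.
by apply: elem_opp; apply: elemM; [exact: elem_cst|exact: elem_sqdist].
Qed.

Lemma elem_kernel y l : elem (kernel y l).
Proof.
rewrite (_ : kernel y l = fun x => l ^+ n * bump 2 (1 + - (l ^+ 2 * sqdist y x))).
  apply: elemM; first exact: elem_cst.
  apply: elem_bump; apply: elemD; first exact: elem_cst.
  by apply: elem_opp; apply: elemM; [exact: elem_cst|exact: elem_sqdist].
by apply/funext => x; rewrite /kernel /mono_bump expr0 mulr1.
Qed.

Lemma is_derive_coor i x j : is_derive x (e_ i) (fun x : V => x ord0 j) ((i == j)%:R : R).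
Proof.
split; last exact: derive_coor.
exact/diff_derivable/differentiable_coord.
Qed.

Lemma is_derive_sqdist y i x : is_derive x (e_ i) (sqdist y) (2 * (x ord0 i - y ord0 i)).
Proof.
have H j : is_derive x (e_ i) (fun x : V => (x ord0 j + - y ord0 j) * (x ord0 j + - y ord0 j))
    (if i == j then 2 * (x ord0 i - y ord0 i) else 0).
  have d1 : is_derive x (e_ i) (fun x : V => x ord0 j + - y ord0 j) ((i == j)%:R : R).
    have := is_derive_coor i x j => d0.
    have := is_deriveD d0 (is_derive_cst (- y ord0 j : R) x (e_ i)).
    by rewrite addr0.
  have D := is_deriveM d1 d1. apply: (is_derive_eq D).
  by rewrite /GRing.scale/=; case: eqP => [->|_] /=; ring.
have := is_derive_sum H.
rewrite (_ : \sum_(j < n) _ = sqdist y); last by apply/funext => z; rewrite fct_sumE.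
by rewrite -big_mkcond/= (big_pred1 i)// => j; rewrite eq_sym.
Qed.

Lemma derive_comp_bump m (f : V -> R) i x (df : R) : differentiable f x ->
  is_derive x (e_ i) f df ->
  is_derive x (e_ i) (fun x => bump m (f x))
    ((bump m.+2 (f x) - m%:R * bump m.+1 (f x)) * df).
Proof.
move=> Df [_ <-]; exact: (is_derive_comp_rV _ Df (is_derive_bump m (f x))).
Qed.

Local Notation Q y l := (fun x => 1 + - (l ^+ 2 * sqdist y x)).

Lemma differentiable_Q y l x : differentiable (Q y l) x.
Proof.
apply: elem_differentiable; apply: elemD; first exact: elem_cst.
by apply: elem_opp; apply: elemM; [exact: elem_cst|exact: elem_sqdist].
Qed.

Lemma is_derive_Q y l i x :
  is_derive x (e_ i) (Q y l) (- (l ^+ 2 * (2 * (x ord0 i - y ord0 i)))).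
Proof.
have d1 := is_deriveZ (l ^+ 2) (is_derive_sqdist y i x).
have := is_deriveD (is_derive_cst (1 : R) x (e_ i)) (is_deriveN d1).
by rewrite add0r.
Qed.

Lemma partials2_potential y l i x : partials [:: i; i] (potential y l) x =
  4 * l ^+ 4 * ((x ord0 i + - y ord0 i) * (x ord0 i + - y ord0 i)) *
    (bump 4 (Q y l x) - 2 * bump 3 (Q y l x)) - 2 * l ^+ 2 * bump 2 (Q y l x).
Proof.
have D1 : (fun x => 'D_(e_ i) (potential y l) x) =
    (fun x => bump 2 (Q y l x)) * (fun x => - (l ^+ 2 * (2 * (x ord0 i - y ord0 i)))).
  apply/funext => z.
  have [_ ->] := derive_comp_bump 0 (differentiable_Q y l z) (is_derive_Q y l i z).
  by rewrite mul0r subr0.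
rewrite /= -/(potential y l) D1.
have d1 : is_derive x (e_ i) (fun x : V => - (l ^+ 2 * (2 * (x ord0 i - y ord0 i))))
    (- (l ^+ 2 * 2)).
  have d0 := is_deriveD (is_derive_coor i x i) (is_derive_cst (- y ord0 i : R) x (e_ i)).
  have := is_deriveN (is_deriveZ (l ^+ 2) (is_deriveZ 2 d0)).
  by rewrite eqxx addr0 /GRing.scale/= mulr1.
have d2 := derive_comp_bump 2 (differentiable_Q y l x) (is_derive_Q y l i x).
have [_ ->] := is_deriveM d2 d1.
rewrite /GRing.scale/=; ring.
Qed.

(* For radial functions, the derivative of the kernel with respect to the scale is the
   Laplacian of a compactly supported function. *)
Lemma lap_potential y l x : 0 < l ->
  lap (fun x => - (l ^+ n / (2 * l ^+ 3)) * potential y l x) x = dkernel y l x.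
Proof.
move=> l0; have ln0 : l != 0 by rewrite gt_eqF.
have sp := elem_smooth (elem_potential y l).
rewrite /lap; under eq_bigr do rewrite (partialsZ _ _ sp) partials2_potential.
rewrite -mulr_sumr sumrB -mulr_suml -mulr_sumr -/(sqdist y x).
rewrite sumr_const card_ord /dkernel /mono_bump.
rewrite !exprS !expr0 !mulr1 [n%:R * (_ * _)]mulrA.
(* For n = 0 the predecessor truncates, but the factor n makes both sides vanish. *)
have -> : n%:R * l ^+ n.-1 = n%:R * l ^+ n / l.
  by case: n => [|m]; rewrite ?mul0r//= exprSr mulrA mulfK.
rewrite -[X in _ - X]mulr_natr.
move: (n%:R : R) (l ^+ n) (sqdist y x) (bump 2 _) (bump 3 _) (bump 4 _) => N L q b2 b3 b4.
by field.
Qed.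

Lemma lapD (f g : V -> R) x : smooth f -> smooth g ->
  lap (fun x => f x + g x) x = lap f x + lap g x.
Proof.
move=> sf sg; rewrite /lap -big_split/=; apply: eq_bigr => i _.
by rewrite -[LHS]/(partials [:: i; i] (fun x => f x + g x) x) partialsD.
Qed.

Lemma lapZ c (f : V -> R) x : smooth f -> lap (fun x => c * f x) x = c * lap f x.
Proof.
move=> sf; rewrite /lap mulr_sumr; apply: eq_bigr => i _.
by rewrite -[LHS]/(partials [:: i; i] (fun x => c * f x) x) partialsZ.
Qed.

(** The mean value theorem evaluates [dkernel] at an intermediate scale, and the Lipschitz bounds in
    l move it back to l. The error is quadratic in the step and uniform in x and y, as the Riemann
    sums below require. *)
Lemma kernel_diff_bound (a b : R) : 0 < a -> exists2 C : R, 0 <= C &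
  forall y x l l', a <= l -> l <= l' -> l' <= b ->
    `|kernel y l' x - kernel y l x - (l' - l) * dkernel y l x| <= C * (l' - l) ^+ 2.
Proof.
move=> a0.
have [C1 C10 H1] := mono_bump_lip n.-1 0 2 b a0.
have [C2 C20 H2] := mono_bump_lip n.+1 1 4 b a0.
have [C3 C30 H3] := mono_bump_lip n.+1 1 3 b a0.
exists (n%:R * C1 + 2 * C2 + 4 * C3).
  by rewrite !addr_ge0// mulr_ge0.
move=> y x l l' al ll' l'b.
have q0 := sqdist_ge0 y x.
have [|c] := @MVT_segment R (mono_bump n 0 2 (sqdist y x)) _ l l' ll'
    (fun z _ => is_derive_mono_bump n 0 2 (sqdist y x) z).
  by apply: derivable_within_continuous => z _; case: (is_derive_mono_bump n 0 2 (sqdist y x) z).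
rewrite in_itv/= => /andP[lc cl']; rewrite /kernel => ->.
have cab : a <= c <= b by apply/andP; split; [exact: le_trans lc|exact: le_trans l'b].
have lab : a <= l <= b by apply/andP; split => //; exact: le_trans l'b.
rewrite [X in `|X - _|]mulrC -mulrBr normrM ger0_norm ?subr_ge0//.
rewrite expr2 mulrA mulrC ler_wpM2r ?subr_ge0//.
have cl : `|c - l| <= l' - l by rewrite ger0_norm ?subr_ge0// lerD2r.
have h1 := le_trans (H1 _ _ _ q0 cab lab) (ler_wpM2l C10 cl).
have h2 := le_trans (H2 _ _ _ q0 cab lab) (ler_wpM2l C20 cl).
have h3 := le_trans (H3 _ _ _ q0 cab lab) (ler_wpM2l C30 cl).
rewrite /dkernel.
move: h1 h2 h3; set A1 := mono_bump _ _ _ _ c; set B1 := mono_bump _ _ _ _ l.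
set A2 := mono_bump n.+1 1 4 _ c; set B2 := mono_bump n.+1 1 4 _ l.
set A3 := mono_bump n.+1 1 3 _ c; set B3 := mono_bump n.+1 1 3 _ l => h1 h2 h3.
rewrite [X in `|X|](_ : _ = n%:R * (A1 - B1) + (- 2) * (A2 - B2) + 4 * (A3 - B3)); last first.
  by rewrite /=; ring.
have Hk (k A D : R) : 0 <= k -> `|A| <= D -> `|k * A| <= k * D.
  by move=> k0 AD; rewrite normrM ger0_norm// ler_wpM2l.
have -> : (n%:R * C1 + 2 * C2 + 4 * C3) * (l' - l) =
  n%:R * (C1 * (l' - l)) + 2 * (C2 * (l' - l)) + 4 * (C3 * (l' - l)) by ring.
apply: le_trans (ler_normD _ _) _; apply: lerD; last exact: Hk.
apply: le_trans (ler_normD _ _) _; apply: lerD; first exact: Hk.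
by rewrite mulNr normrN; exact: Hk.
Qed.

(** Membership in the uniform closure of the Laplacians of test functions in U. Uniform closeness is
    enough because g is integrable, see [key_lapapprox]. *)
Definition lapapprox (U : set V) (w : V -> R) := forall e : R, 0 < e ->
  exists2 phi, test_function U phi & forall x, `|lap phi x - w x| <= e.

Lemma lapapproxZ (U : set V) c w : lapapprox U w -> lapapprox U (fun x => c * w x).
Proof.
move=> H e e0; have e'0 : 0 < e / (`|c| + 1) by rewrite divr_gt0// ltr_wpDl.
have [phi tphi phie] := H _ e'0; exists (fun x => c * phi x).
  exact: test_functionZ.
move=> x; rewrite lapZ; last by case: tphi.
rewrite -mulrBr normrM; apply: (@le_trans _ _ ((`|c| + 1) * (e / (`|c| + 1)))).
  by apply: ler_pM => //; rewrite lerDl.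
by rewrite mulrC divfK// gt_eqF// ltr_wpDl.
Qed.

Lemma lapapproxD (U : set V) w w' : lapapprox U w -> lapapprox U w' ->
  lapapprox U (fun x => w x + w' x).
Proof.
move=> H H' e e0; have e20 : 0 < e / 2 by rewrite divr_gt0.
have [phi tphi phie] := H _ e20; have [psi tpsi psie] := H' _ e20.
exists (fun x => phi x + psi x); first exact: test_functionD.
move=> x; rewrite lapD; [|by case: tphi|by case: tpsi].
rewrite opprD addrACA [e]splitr; apply: le_trans (ler_normD _ _) _.
exact: lerD.
Qed.

Lemma lapapprox0 (U : set V) : lapapprox U (fun=> 0).
Proof.
move=> e e0; exists (fun=> 0).
  by split; [exact: elem_smooth (elem_cst 0)|exists set0; split => //; exact: compact0].
move=> x; have := lapZ 0 x (elem_smooth (elem_cst (0 : R))).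
under eq_fun do rewrite mul0r.
by rewrite mul0r => ->; rewrite subr0 normr0 ltW.
Qed.

Lemma lapapprox_sum (U : set V) (I : Type) (s : seq I) (w : I -> V -> R) :
  (forall i, lapapprox U (w i)) -> lapapprox U (fun x => \sum_(i <- s) w i x).
Proof.
move=> H; elim: s => [|i s IH].
  under eq_fun do rewrite big_nil.
  exact: lapapprox0.
under eq_fun do rewrite big_cons.
exact: lapapproxD.
Qed.

Lemma sqdist_coor y x i : (x ord0 i - y ord0 i) ^+ 2 <= sqdist y x.
Proof.
rewrite /sqdist (bigD1 i)//= -expr2 lerDl; apply: sumr_ge0 => j _.
by rewrite -expr2 sqr_ge0.
Qed.

Lemma sqdist_norm y x a : 0 < a -> 0 <= 1 - a ^+ 2 * sqdist y x -> `|x - y| <= a^-1.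
Proof.
move=> a0 h; apply/ler_addgt0Pr => e e0; apply/ltW/rV_norm_lt.
  by rewrite addr_gt0// invr_gt0.
move=> i; rewrite !mxE ltr_pwDr// -(ler_pM2l a0) mulfV ?gt_eqF//.
rewrite -[X in X * _](ger0_norm (ltW a0)) -normrM -(@expr_le1 _ 2)// real_normK ?num_real//.
rewrite exprMn; apply: (@le_trans _ _ (a ^+ 2 * sqdist y x)); last lra.
by rewrite ler_wpM2l ?sqr_ge0// sqdist_coor.
Qed.

Lemma compact_sqdist y a : 0 < a -> compact [set x | 0 <= 1 - a ^+ 2 * sqdist y x].
Proof.
move=> a0; apply: bounded_closed_compact.
  exists (`|y| + a^-1); split; first exact: num_real.
  move=> M hM x /= h; apply: le_trans (ltW hM).
  have := sqdist_norm a0 h; have := ler_normD y (x - y); rewrite addrC subrK; lra.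
rewrite [X in closed X](_ : _ = (fun x => 1 + - (a ^+ 2 * sqdist y x)) @^-1` [set t | 0 <= t])//.
apply: preimage_closed; last exact: closed_ge.
by move=> x _; exact/differentiable_continuous/differentiable_Q.
Qed.

(* Integrate [lap_potential] in the scale; a Riemann sum replaces the integral so that
   no differentiation under the integral sign is needed. *)
Lemma lapapprox_kernelB (U : set V) y a b : 0 < a -> a <= b ->
  (forall x, 0 <= 1 - a ^+ 2 * sqdist y x -> U x) ->
  lapapprox U (fun x => kernel y b x - kernel y a x).
Proof.
move=> a0 ab aU e e0.
have [C C0 HC] := kernel_diff_bound b a0.
(* Each of the N steps has length d = (b - a) / N and error C d^2, so the total error is C (b - a)^2
   / N. *)
pose N := (Num.truncn (C * (b - a) ^+ 2 / e)).+1.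
have N0 : 0 < N%:R :> R by rewrite ltr0n.
have Ne : C * (b - a) ^+ 2 / N%:R <= e.
  by rewrite ler_pdivrMr// -ler_pdivrMl// mulrC ltW// truncnS_gt.
pose d := (b - a) / N%:R.
have d0 : 0 <= d by rewrite divr_ge0// subr_ge0.
pose t (j : nat) := a + j%:R * d.
have at_ j : a <= t j by rewrite lerDl mulr_ge0.
have tS j : t j.+1 - t j = d by rewrite /t -natr1; ring.
have tN : t N = b by rewrite /t /d mulrC divfK ?gt_eqF// addrC subrK.
have tb j : (j <= N)%N -> t j <= b.
  by move=> jN; rewrite -tN lerD2l ler_wpM2r// ler_nat.
pose F (j : 'I_N) (x : V) := d * (- (t j ^+ n / (2 * t j ^+ 3)) * potential y (t j) x).
have tF j : test_function U (F j).
  do 2 apply: test_functionZ; split; first exact: elem_smooth (elem_potential _ _).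
  (* Every scale satisfies t j >= a, so the ball of the largest radius 1/a contains all the
     supports. *)
  exists [set x | 0 <= 1 - a ^+ 2 * sqdist y x]; split => //.
    exact: compact_sqdist.
  move=> x /= /negP; rewrite -ltNge => h; rewrite /potential bump_npos//.
  apply: le_trans (ltW h); rewrite lerD2l lerN2 ler_wpM2r ?sqdist_ge0//.
  by rewrite lerXn2r ?nnegrE// ?(le_trans (ltW a0)).
exists (fun x => \sum_(j < N) F j x); first exact: test_function_sum.
move=> x.
have lapF : lap (fun x => \sum_(j < N) F j x) x = \sum_(j < N) d * dkernel y (t j) x.
  have sF j : smooth (F j) by case: (tF j).
  elim: (index_enum _) => [|j s IH].
    under eq_fun do rewrite big_nil.
    rewrite big_nil; have := lapZ 0 x (elem_smooth (elem_cst (0 : R))).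
    under eq_fun do rewrite mul0r.
    by rewrite mul0r.
  under eq_fun do rewrite big_cons.
  rewrite big_cons -IH lapD//; last first.
    by have [] := @test_function_sum _ _ _ s U F tF.
  congr (_ + _); rewrite lapZ; last by apply: smoothZ; exact: elem_smooth (elem_potential _ _).
  by rewrite lap_potential// (lt_le_trans a0).
rewrite lapF.
have -> : kernel y b x - kernel y a x = \sum_(j < N) (kernel y (t j.+1) x - kernel y (t j) x).
  rewrite -(big_mkord xpredT (fun j => kernel y (t j.+1) x - kernel y (t j) x)).
  rewrite telescope_sumr// tN; congr (_ - kernel y _ x).
  by rewrite /t mul0r addr0.
rewrite -sumrB; apply: le_trans (ler_norm_sum _ _ _) _.
apply: le_trans Ne.
have -> : C * (b - a) ^+ 2 / N%:R = \sum_(j < N) (C * d ^+ 2).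
  rewrite sumr_const card_ord -mulr_natr /d; field; exact: lt0r_neq0.
apply: ler_sum => j _; rewrite distrC -(tS j).
by apply: HC => //; [rewrite -subr_ge0 tS|exact: tb].
Qed.

End kernels.

(** * Discretized convolutions *)

Section discretization.
Context {R : realType} {n : nat}.
Local Notation V := ('rV[R]_n).
Local Notation mu := (@lebesgue_rV R n).

(* Finite sums replace convolutions: a finite combination of translated kernels is
   smooth for free. *)
Definition discretizes (d : R) (U : set V) (psi : V -> R) (s : seq (R * V)) :=
  [/\ forall p, p \in s -> U p.2,
    \sum_(p <- s) `|p.1| <= \int[mu]_(x in U) `|psi x|,
    \sum_(p <- s) p.1 = \int[mu]_(x in U) psi x &
    forall (k : V -> R) (e B : R), measurable_fun setT k -> (forall x, `|k x| <= B) ->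
      (forall y y', `|y - y'| <= d -> `|k y - k y'| <= e) ->
      `|\int[mu]_(x in U) (psi x * k x) - \sum_(p <- s) p.1 * k p.2| <=
        e * \int[mu]_(x in U) `|psi x|].

(** Induction on the cover: the part of U in the first ball is replaced by one of its points,
    weighted by the integral of psi over that part. Points of the same ball of radius d / 2 are
    within d of each other. *)
Lemma discretize_cover (d : R) (U : set V) (psi : V -> R) (zs : seq V) :
  measurable U -> mu.-integrable U (EFin \o psi) ->
  U `<=` \bigcup_(z in [set` zs]) ball z (d / 2) ->
  exists s, discretizes d U psi s.
Proof.
elim: zs U => [|z zs IH] U mU Ipsi Uzs.
  have -> : U = set0 by rewrite -subset0 => x /Uzs[z].
  exists [::]; split; rewrite ?big_nil ?Rintegral_set0// => k e B _ _ _.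
  by rewrite big_nil !Rintegral_set0 mulr0 subrr normr0.
have mB := measurable_ball_rV z (d / 2).
pose U1 := U `&` ball z (d / 2); pose U2 := U `\` ball z (d / 2).
have mU1 : measurable U1 by exact: measurableI.
have mU2 : measurable U2 by exact: measurableD.
have UE : U = U1 `|` U2 by rewrite /U1 /U2 setUIDK.
have I1 : mu.-integrable U1 (EFin \o psi) by apply: intbleS Ipsi => //; exact: subIsetl.
have I2 : mu.-integrable U2 (EFin \o psi) by apply: intbleS Ipsi => //; exact: subDsetl.
have [|s2 [s2U s2n s2i s2k]] := IH U2 mU2 I2.
  move=> x [Ux xz]; have [w /= ] := Uzs x Ux.
  by rewrite inE => /orP[/eqP->//|wzs wx]; exists w.
(* An empty piece offers no point to carry a weight and needs none. *)
have [U1e|/set0P[y U1y]] := eqVneq U1 set0.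
  by exists s2; move: UE; rewrite U1e set0U => ->.
have dU : [disjoint U1 & U2].
  by apply/disj_setPS => x [[_ ?] [_ ?]].
have split_int (f : V -> R) : mu.-integrable U (EFin \o f) ->
    \int[mu]_(x in U) f x = \int[mu]_(x in U1) f x + \int[mu]_(x in U2) f x.
  by move=> If; rewrite {1}UE Rintegral_setU// -UE.
exists ((\int[mu]_(x in U1) psi x, y) :: s2); split.
- by move=> p; rewrite inE => /orP[/eqP->/=|/s2U []//]; case: U1y.
- rewrite big_cons split_int; last exact: integrable_norm.
  by apply: lerD => //=; exact: le_normr_Rintegral.
- by rewrite big_cons split_int// s2i.
move=> k e B mk kB ke; rewrite big_cons !split_int; last 2 first.
- exact: integrable_norm.
- by apply: (@intbleM _ _ _ _ _ _ _ B) => //; exact: measurable_funS mk.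
rewrite opprD addrACA mulrDr; apply: le_trans (ler_normD _ _) _.
apply: lerD; last exact: s2k.
have mk1 : measurable_fun U1 k by exact: measurable_funS mk.
have Ipk : mu.-integrable U1 (EFin \o (fun x => psi x * k x)).
  exact: (@intbleM _ _ _ _ _ _ _ B).
rewrite /= mulrC -RintegralZl// -RintegralB//; last exact: intbleZ.
rewrite -RintegralZl//; last exact: integrable_norm.
have mpsi := intble_measurable I1.
apply: Rint_norm_le => //.
- by apply: measurable_funB; exact: measurable_funM.
- by apply: intbleZ => //; exact: integrable_norm.
move=> x [Ux zx]; rewrite mulrC -mulrBl normrM ler_wpM2r//.
have [_ zy] := U1y; apply: ke.
move: zx zy => /rV_ballE zx /rV_ballE zy.
have := ler_normB (z - y) (z - x).
rewrite (_ : z - y - (z - x) = x - y); last by rewrite opprB [LHS]addrC addrA subrK.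
have : d / 2 + d / 2 = d by rewrite -splitr.
lra.
Qed.

Lemma discretize (d : R) (x0 : V) (r : R) (psi : V -> R) : 0 < d ->
  mu.-integrable (ball x0 r) (EFin \o psi) ->
  exists s, discretizes d (ball x0 r) psi s.
Proof.
move=> d0 Ipsi.
pose K := [set y : V | `|x0 - y| <= r].
have cK : compact K by exact: compact_le_ball.
have : cover_compact K by rewrite -compact_cover.
move=> /(_ V K (fun z => ball z (d / 2))) [].
- by move=> z _; exact: ball_open.
- by move=> z Kz; exists z => //; apply: ballxx; rewrite divr_gt0.
move=> D' _ KD'; apply: (@discretize_cover _ _ _ (finmap.enum_fset D')) => //.
  exact: measurable_ball_rV.
by move=> x /rV_ballE/ltW/KD' [z zD' zx]; exists z.
Qed.

End discretization.

(** * Size, regularity and mass of the kernels *)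

Section kernel_properties.
Context {R : realType} {n : nat}.
Local Notation V := ('rV[R]_n).
Local Notation mu := (@lebesgue_rV R n).
Local Notation e_ i := (delta_mx ord0 i : V).
Local Notation kernel1 := (@kernel R n 0 1).

Lemma kernelE (y : V) (l : R) x : kernel y l x = l ^+ n * kernel1 (l *: (x - y)).
Proof.
rewrite /kernel /mono_bump !expr0 !mulr1 !expr1n mul1r; congr (_ * bump _ (_ - _)).
rewrite mul1r /sqdist mulr_sumr; apply: eq_bigr => i _; rewrite !mxE; ring.
Qed.

Lemma kernelC (y : V) (l : R) x : kernel y l x = kernel x l y.
Proof.
rewrite /kernel; congr (mono_bump _ _ _ _ _); apply: eq_bigr => i _; ring.
Qed.

Lemma kernel_ge0 (y : V) l x : 0 <= l -> 0 <= kernel y l x.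
Proof.
by move=> l0; rewrite /kernel /mono_bump expr0 mulr1 mulr_ge0 ?exprn_ge0 ?bump_ge0.
Qed.

Lemma kernel_le (y : V) l x : 0 <= l -> kernel y l x <= 2 * l ^+ n.
Proof.
move=> l0; rewrite /kernel /mono_bump expr0 mulr1 mulrC ler_wpM2r ?exprn_ge0//.
exact: bump_le.
Qed.

Lemma kernel_off (y : V) l x : 0 < l -> l^-1 < `|x - y| -> kernel y l x = 0.
Proof.
move=> l0 h; rewrite /kernel /mono_bump bump_npos ?mulr0// leNgt; apply/negP => /ltW h'.
by have := sqdist_norm l0 h'; rewrite leNgt h.
Qed.

Lemma sqdist0_lip (z z' : V) : `|z| <= 2 -> `|z'| <= 2 ->
  `|sqdist 0 z - sqdist 0 z'| <= n%:R * 4 * `|z - z'|.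
Proof.
move=> z2 z'2; rewrite /sqdist -sumrB.
apply: (@le_trans _ _ (\sum_(i < n) 4 * `|z - z'|)); last first.
  by rewrite sumr_const card_ord -[leLHS]mulr_natl mulrA.
apply: le_trans (ler_norm_sum _ _ _) _; apply: ler_sum => i _.
have h1 := rV_norm_coor (z - z') i; have h2 := rV_norm_coor z i.
have h3 := rV_norm_coor z' i; rewrite !mxE in h1 *.
rewrite [X in `|X|](_ : _ = (z ord0 i + z' ord0 i) * (z ord0 i - z' ord0 i)); last ring.
rewrite normrM; apply: ler_pM => //.
apply: le_trans (ler_normD _ _) _; lra.
Qed.

(** The squared norm is Lipschitz on bounded sets only. If one point has norm above 2, the
    difference is nonzero only when the other lies in the unit ball; then |z - z'| >= 1 while the
    kernel is at most 2, hence the added 2. *)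
Lemma kernel1_lip : exists2 C : R, 0 <= C & forall z z' : V,
  `|kernel1 z - kernel1 z'| <= C * `|z - z'|.
Proof.
have [C C0 HC] := bump_lip (R := R) 2.
exists (C * (n%:R * 4) + 2); first by rewrite addr_ge0// !mulr_ge0.
have far (z z' : V) : 2 < `|z| -> `|kernel1 z - kernel1 z'| <= (C * (n%:R * 4) + 2) * `|z - z'|.
  move=> z2; rewrite kernel_off ?ltr01//; last by rewrite subr0 invr1; lra.
  rewrite sub0r normrN ger0_norm ?kernel_ge0//.
  have [z'1|z'1] := leP `|z'| 1; last first.
    by rewrite kernel_off ?subr0 ?invr1// mulr_ge0// addr_ge0// !mulr_ge0.
  have zz' : 1 <= `|z - z'| by have := lerB_dist z z'; lra.
  apply: (@le_trans _ _ (2 * `|z - z'|)).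
    apply: le_trans (kernel_le _ _ (ler01)) _; rewrite expr1n; lra.
  by rewrite ler_wpM2r// lerDr !mulr_ge0.
move=> z z'; have [z2|/far//] := leP `|z| 2.
have [z'2|/far h] := leP `|z'| 2; last by rewrite distrC [`|z - z'|]distrC.
rewrite /kernel /mono_bump !expr0 !mulr1 !expr1n !mul1r.
apply: le_trans (HC _ _) _; rewrite opprB addrCA addrAC subrr add0r.
apply: (@le_trans _ _ (C * (n%:R * 4 * `|z - z'|))).
  by rewrite ler_wpM2l// distrC sqdist0_lip.
by rewrite [leLHS]mulrA ler_wpM2r// lerDl.
Qed.

(** By scaling from [kernel1_lip]: l^n is the normalization and one more l comes from the
    dilation. *)
Lemma kernel_lip : exists2 C : R, 0 <= C & forall (y y' x : V) (l : R), 0 <= l ->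
  `|kernel y l x - kernel y' l x| <= C * l ^+ n.+1 * `|y - y'|.
Proof.
have [C C0 HC] := kernel1_lip; exists C => // y y' x l l0.
rewrite (kernelE y) (kernelE y') -mulrBr normrM ger0_norm ?exprn_ge0//.
have -> : C * l ^+ n.+1 * `|y - y'| = l ^+ n * (C * (l * `|y - y'|)) by rewrite exprSr; ring.
rewrite ler_wpM2l ?exprn_ge0//; apply: le_trans (HC _ _) _.
rewrite ler_wpM2l// -scalerBr normrZ ger0_norm//.
by rewrite opprB addrC addrA subrK distrC.
Qed.

Lemma kernel_intble (y : V) l D : 0 < l -> measurable D ->
  mu.-integrable D (EFin \o kernel y l).
Proof.
move=> l0 mD; apply: (@compact_support_intble _ _ _ [set x | 0 <= 1 - l ^+ 2 * sqdist y x]) => //.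
- exact/smooth_continuous/elem_smooth/elem_kernel.
- exact: compact_sqdist.
- move=> x /= /negP; rewrite -ltNge => /ltW h.
  by rewrite /kernel /mono_bump bump_npos ?mulr0.
Qed.

Definition kernel_mass : R := \int[mu]_x kernel1 x.

Lemma Rint_kernel (y : V) l : 0 < l -> \int[mu]_x kernel y l x = kernel_mass.
Proof.
move=> l0; have l0' := ltW l0.
have mk : measurable_fun setT kernel1 by exact: elem_measurable (elem_kernel _ _).
rewrite /kernel_mass /Rintegral; congr fine.
rewrite -(@integral_lebesgue_rV_aff _ _ l (- (l *: y)) (EFin \o kernel1))//; last 2 first.
- exact/measurable_EFinP.
- by move=> x; rewrite lee_fin kernel_ge0.
rewrite -ge0_integralZl//; last 3 first.
- apply/measurable_EFinP; apply: measurableT_comp mk _; exact: measurable_aff.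
- by move=> x _; rewrite lee_fin kernel_ge0.
- by rewrite lee_fin exprn_ge0.
by apply: eq_integral => x _; rewrite kernelE -EFinM/= /aff scalerBr.
Qed.

Lemma kernel_mass_gt0 : 0 < kernel_mass.
Proof.
have k00 : 0 < kernel1 0.
  rewrite /kernel /mono_bump !expr0 !expr1n !mul1r bump_gt0//.
  by rewrite /sqdist big1 ?subr0// => i _; rewrite subrr mulr0.
have ck : continuous kernel1 by exact/smooth_continuous/elem_smooth/elem_kernel.
have := ck 0; move=> /cvgrPdist_lt/(_ _ (divr_gt0 k00 (ltr0Sn _ 1)))/nbhs_ballP[d /= d0 hd].
have mB := measurable_ball_rV (0 : V) d.
apply: (@lt_le_trans _ _ (\int[mu]_(x in ball (0:V) d) (kernel1 0 / 2))).
  rewrite Rintegral_cst// mulr_gt0// ?divr_gt0//.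
  by rewrite [X in fine X](lebesgue_rV_ball _ d0)/= exprn_gt0// mulr_gt0.
have Ik D (mD : measurable D) := kernel_intble (0 : V) ltr01 mD.
apply: (@le_trans _ _ (\int[mu]_(x in ball (0:V) d) kernel1 x)).
  apply: le_Rintegral => //; [|exact: Ik|].
    apply: (@intble_bounded _ _ _ _ _ _ (kernel1 0 / 2)) => //; first exact: ball_lty.
    by move=> x _; rewrite ger0_norm// divr_ge0// ltW.
  move=> x /hd /=; rewrite ltr_norml => /andP[_]; lra.
apply: le_Rint_set => //; first exact: Ik.
by move=> x _; exact: kernel_ge0.
Qed.

Lemma elem_lip (D : set V) (psi : V -> R) : elem psi -> test_function D psi ->
  exists2 L : R, 0 <= L & forall x y, `|psi x - psi y| <= L * `|x - y|.
Proof.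
move=> epsi tpsi.
have /choice[M HM] : forall i : 'I_n, exists M : R, 0 <= M /\ forall x, `|'D_(e_ i) psi x| <= M.
  move=> i; have [M M0 HM] := test_function_bounded (test_function_partials [:: i] tpsi).
  by exists M.
exists (\sum_(i < n) M i); first by apply: sumr_ge0 => i _; case: (HM i).
move=> x y; have dpsi z := elem_differentiable epsi z.
have DE z : `|'D_(x - y) psi z| <= (\sum_(i < n) M i) * `|x - y|.
  have -> : 'D_(x - y) psi z = \sum_(i < n) (x - y) ord0 i * 'D_(e_ i) psi z.
    rewrite deriveE// {1}[x - y]row_sum_delta linear_sum.
    by apply: eq_bigr => i _; rewrite linearZ/= -deriveE.
  rewrite mulr_suml.
  apply: le_trans (ler_norm_sum _ _ _) _; apply: ler_sum => i _.
  rewrite normrM mulrC ler_pM//; first by case: (HM i).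
  exact: rV_norm_coor.
have dv z : derivable psi z (x - y) by exact: diff_derivable.
have := @le_line_increment _ _ psi (x - y) y _ 1 ler01 dv DE.
by rewrite scale1r subrK mulr1.
Qed.

(** A finite-sum form of the convergence of mollifications. If psi is L-Lipschitz, averaging it over
    radius 1/l costs at most L / l <= e / 2, and discretizing the average costs another e / 2.
    Dividing the weights by [kernel_mass] normalizes the kernel. *)
Lemma approx_kernel_sum (x0 : V) (r : R) (psi : V -> R) (e l0 : R) :
  elem psi -> test_function (ball x0 r) psi -> 0 < e -> 0 < l0 ->
  exists (l : R) (s : seq (R * V)), [/\ l0 <= l,
    forall p, p \in s -> ball x0 r p.2,
    kernel_mass * \sum_(p <- s) `|p.1| <= \int[mu]_(x in ball x0 r) `|psi x|,
    kernel_mass * \sum_(p <- s) p.1 = \int[mu]_(x in ball x0 r) psi x &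
    forall x, `|\sum_(p <- s) p.1 * kernel p.2 l x - psi x| <= e].
Proof.
move=> epsi tpsi e0 l00; set U := ball x0 r.
have mU : measurable U := measurable_ball_rV x0 r.
have m0 := kernel_mass_gt0; set m := kernel_mass in m0 *.
have [L L0 HL] := elem_lip epsi tpsi.
have [C C0 HC] := kernel_lip.
have [sp [K [cK KU pK]]] := tpsi.
have Ipsi D : measurable D -> mu.-integrable D (EFin \o psi).
  by move=> mD; apply: (@compact_support_intble _ _ _ K) => //; exact: smooth_continuous.
set I := \int[mu]_(x in U) `|psi x|.
have I0 : 0 <= I by exact: Rintegral_ge0.
pose l := l0 + 2 * L / e.
have l_ge : l0 <= l by rewrite lerDl divr_ge0 ?mulr_ge0// ltW.
have l_gt0 : 0 < l by exact: lt_le_trans l_ge.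
have Ll : L / l <= e / 2.
  have : 2 * L / e <= l by rewrite lerDr ltW.
  rewrite ler_pdivrMr// ler_pdivrMr//; lra.
(* The tolerance on the kernel is chosen so that the discretization error e' I is at most m e / 2;
   the 1 covers I = 0. *)
pose e' := e / 2 * m / (I + 1).
have e'0 : 0 < e' by rewrite divr_gt0 ?mulr_gt0 ?divr_gt0// ltr_wpDl.
pose Cl := C * l ^+ n.+1 + 1.
have Cl0 : 0 < Cl by rewrite ltr_wpDl// mulr_ge0// exprn_ge0// ltW.
have [s [sU sn si sk]] := discretize (divr_gt0 e'0 Cl0) (Ipsi _ mU).
exists l, [seq (p.1 / m, p.2) | p <- s]; split => //.
- by move=> _ /mapP[p ps ->]; exact: (sU p ps).
- rewrite big_map/= (eq_bigr (fun p : R * V => m^-1 * `|p.1|)); last first.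
    by move=> p _; rewrite normrM [`|m^-1|]ger0_norm ?invr_ge0 ?ltW// mulrC.
  by rewrite -mulr_sumr mulrA mulfV ?mul1r// gt_eqF.
- rewrite big_map/= -mulr_suml mulrC divfK// gt_eqF//.
move=> x; rewrite big_map/=.
pose k y := kernel y l x.
have kE : k = kernel x l by apply/funext => y; exact: kernelC.
have mk : measurable_fun setT k by rewrite kE; exact: elem_measurable (elem_kernel _ _).
have Ik : mu.-integrable setT (EFin \o k) by rewrite kE; exact: kernel_intble.
have kB y : `|k y| <= 2 * l ^+ n.
  by rewrite ger0_norm; [apply: kernel_le|apply: kernel_ge0]; exact: ltW.
have ke y y' : `|y - y'| <= e' / Cl -> `|k y - k y'| <= e'.
  move=> yy'; apply: le_trans (HC y y' x l (ltW l_gt0)) _.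
  apply: (@le_trans _ _ (Cl * (e' / Cl))); last by rewrite mulrC divfK// gt_eqF.
  by apply: ler_pM => //; [rewrite mulr_ge0// exprn_ge0// ltW|rewrite lerDl].
have h1 := sk k e' _ mk kB ke.
have Ipk : mu.-integrable setT (EFin \o (fun y => psi y * k y)).
  by apply: (@intbleM _ _ _ _ _ _ _ (2 * l ^+ n)) => //; exact: Ipsi.
have h2 : `|\int[mu]_(y in U) (psi y * k y) - psi x * m| <= e / 2 * m.
  rewrite -(@Rint_sub _ _ _ mu setT U)//; last first.
    by move=> y _ Uy; rewrite pK ?mul0r// => /KU.
  rewrite /m -(Rint_kernel x l_gt0) -kE -!RintegralZl// -RintegralB//; last exact: intbleZ.
  apply: Rint_norm_le => //.
  - apply: measurable_funB; first exact: intble_measurable Ipk.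
    exact: measurable_funM.
  - exact: intbleZ.
  move=> y _; rewrite -mulrBl normrM.
  have k0 : 0 <= k y by apply: kernel_ge0; exact: ltW.
  rewrite (ger0_norm k0).
  have [h|h] := leP `|x - y| l^-1.
    rewrite ler_wpM2r//; apply: le_trans (HL _ _) _.
    by apply: le_trans Ll; rewrite distrC ler_wpM2l.
  by rewrite /k kernel_off// !mulr0.
rewrite -(ler_pM2l m0) -[X in X * `|_|](ger0_norm (ltW m0)) -normrM mulrBr.
have -> : m * (\sum_(p <- s) p.1 / m * kernel p.2 l x) = \sum_(p <- s) p.1 * k p.2.
  rewrite mulr_sumr; apply: eq_bigr => p _.
  by rewrite mulrA [m * _]mulrC divfK// gt_eqF.
have e'I : e' * I <= e / 2 * m.
  rewrite /e' -[leRHS](@divfK _ (I + 1)) ?gt_eqF ?ltr_wpDl// ler_wpM2l ?lerDl//.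
  by rewrite ltW.
have -> : \sum_(p <- s) p.1 * k p.2 - m * psi x =
   (\int[mu]_(y in U) (psi y * k y) - psi x * m) -
   (\int[mu]_(y in U) (psi y * k y) - \sum_(p <- s) p.1 * k p.2) by ring.
apply: le_trans (ler_normB _ _) _.
have -> : m * e = e / 2 * m + e / 2 * m by field.
apply: lerD => //; exact: le_trans h1 e'I.
Qed.

End kernel_properties.

(** * Mean oscillation *)

Section oscillation.
Context {R : realType} {n : nat}.
Local Notation V := ('rV[R]_n).
Local Notation mu := (@lebesgue_rV R n).
Context (Omega : set V) (oO : open Omega) (g : V -> R)
  (Ig : mu.-integrable Omega (EFin \o g)).
Hypothesis key : forall (U : set V) (phi : V -> R) (M : R), measurable U ->
  U `<=` Omega -> test_function U phi -> 0 < M -> (forall x, `|lap phi x| <= M) ->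
  `|\int[mu]_(x in Omega) (g x * lap phi x)| <= M * fine (mu U).

Let mO : measurable Omega. Proof. exact: open_measurable_rV. Qed.
Let I := \int[mu]_(x in Omega) `|g x|.
Let I0 : 0 <= I. Proof. exact: Rintegral_ge0. Qed.

Lemma intble_gM (w : V -> R) M : measurable_fun setT w -> (forall x, `|w x| <= M) ->
  mu.-integrable Omega (EFin \o (fun x => g x * w x)).
Proof.
by move=> mw wM; apply: (@intbleM _ _ _ _ _ _ _ M) => //; exact: measurable_funS mw.
Qed.

Lemma Rint_gM_le (w : V -> R) M : measurable_fun setT w -> (forall x, `|w x| <= M) ->
  `|\int[mu]_(x in Omega) (g x * w x)| <= I * M.
Proof.
move=> mw wM; rewrite /I mulrC -RintegralZl//; last exact: integrable_norm.
apply: Rint_norm_le => //.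
- exact: intble_measurable (intble_gM mw wM).
- by apply: intbleZ => //; exact: integrable_norm.
- by move=> x _; rewrite normrM mulrC ler_wpM2r.
Qed.

Lemma fine_ball (x : V) (r : R) : 0 < r -> fine (mu (ball x r)) = (2 * r) ^+ n.
Proof. by move=> r0; rewrite [X in fine X](lebesgue_rV_ball x r0). Qed.

Lemma key_lapapprox (x : V) (r M : R) (w : V -> R) : 0 < r -> ball x r `<=` Omega ->
  measurable_fun setT w -> lapapprox (ball x r) w -> (forall x, `|w x| <= M) ->
  `|\int[mu]_(x in Omega) (g x * w x)| <= M * (2 * r) ^+ n.
Proof.
move=> r0 rO mw aw wM; have M0 : 0 <= M by exact: le_trans (normr_ge0 _) (wM 0).
set W := (2 * r) ^+ n; have W0 : 0 <= W by rewrite exprn_ge0// mulr_ge0// ltW.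
apply/ler_addgt0Pr => e e0.
(* The tolerance d is paid twice: d W through the larger sup bound M + d, and d I for replacing w by
   lap phi. *)
pose d := e / (W + I + 1).
have d0 : 0 < d by rewrite divr_gt0// ltr_wpDl// addr_ge0.
have de : d * (W + I) <= e.
  rewrite -[leRHS](@divfK _ (W + I + 1)) ?gt_eqF ?ltr_wpDl ?addr_ge0//.
  by rewrite ler_wpM2l ?lerDl// ltW.
have [phi tphi phid] := aw _ d0.
have ml := test_function_measurable (test_function_lap tphi).
have lM z : `|lap phi z| <= M + d.
  have := ler_normD (w z) (lap phi z - w z); rewrite addrC subrK => h.
  by apply: le_trans h _; exact: lerD.
have Md0 : 0 < M + d by rewrite ltr_wpDl.
have := key (measurable_ball_rV x r) rO tphi Md0 lM; rewrite fine_ball// -/W => h.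
have -> : \int[mu]_(x in Omega) (g x * w x) =
    \int[mu]_(x in Omega) (g x * lap phi x) - \int[mu]_(x in Omega) (g x * (lap phi x - w x)).
  rewrite -RintegralB//; [|exact: intble_gM ml lM|].
    by apply: eq_Rintegral => z _; ring.
  by apply: (intble_gM (M := d)) => //; exact: measurable_funB.
apply: le_trans (ler_normB _ _) _.
apply: (@le_trans _ _ ((M + d) * W + I * d)); last lra.
by apply: lerD => //; apply: Rint_gM_le => //; exact: measurable_funB.
Qed.

(* The mollification of [g], up to the factor [kernel_mass]. *)
Definition smear (l : R) (y : V) : R := \int[mu]_(x in Omega) (g x * kernel y l x).

Lemma mkernel (y : V) l : measurable_fun setT (kernel y l).
Proof. exact: elem_measurable (elem_kernel _ _). Qed.

Lemma kernel_norm_le (y : V) l x : 0 <= l -> `|kernel y l x| <= 2 * l ^+ n.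
Proof. by move=> l0; rewrite ger0_norm ?kernel_le ?kernel_ge0. Qed.

Lemma intble_kernel (y : V) l : 0 <= l ->
  mu.-integrable Omega (EFin \o (fun x => g x * kernel y l x)).
Proof. by move=> l0; apply: intble_gM (mkernel y l) (fun x => kernel_norm_le y x l0). Qed.

(** The function tested against g is the increment of the kernel at x minus that at y. It lives
    within 3 r < 4 r of x and is O(r^(-n-1) |x - y|) by [kernel_lip]; the volume (8 r)^n leaves |x -
    y| / r. *)
Lemma smear_lip1 : exists2 K : R, 0 <= K & forall (x y : V) (r : R), 0 < r ->
  ball x (4 * r) `<=` Omega -> `|x - y| <= r ->
  `|(smear r^-1 x - smear r^-1 y) - (smear (2 * r)^-1 x - smear (2 * r)^-1 y)|
    <= K * (`|x - y| / r).
Proof.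
have [C C0 HC] := @kernel_lip R n.
exists (2 * C * 8 ^+ n); first by rewrite !mulr_ge0// exprn_ge0.
move=> x y r r0 rO xy.
set a := r^-1; set b := (2 * r)^-1.
have a0 : 0 < a by rewrite invr_gt0.
have b0 : 0 < b by rewrite invr_gt0 mulr_gt0.
have ba : b <= a by rewrite lef_pV2 ?posrE ?mulr_gt0// ler_peMl ?ler1n// ltW.
pose w (z : V) := (kernel x a z - kernel x b z) + (-1) * (kernel y a z - kernel y b z).
have near_sub (c : V) : `|x - c| <= r -> forall z, 0 <= 1 - b ^+ 2 * sqdist c z -> ball x (4 * r) z.
  move=> xc z /(sqdist_norm b0); rewrite /b invrK => zc.
  apply/rV_ballE; rewrite -(subrK c x) -addrA.
  apply: le_lt_trans (ler_normD _ _) _; rewrite [`|c - z|]distrC; lra.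
have aw : lapapprox (ball x (4 * r)) w.
  apply: lapapproxD.
    by apply: lapapprox_kernelB => //; apply: near_sub; rewrite subrr normr0 ltW.
  by apply: lapapproxZ; apply: lapapprox_kernelB => //; exact: near_sub.
have mw : measurable_fun setT w.
  apply: measurable_funD; first by apply: measurable_funB; exact: mkernel.
  by apply: measurable_funM => //; apply: measurable_funB; exact: mkernel.
have wM z : `|w z| <= 2 * C * a ^+ n.+1 * `|x - y|.
  rewrite /w mulN1r opprB addrACA addrC.
  rewrite [X in `|X|](_ : _ = (kernel x a z - kernel y a z) -
    (kernel x b z - kernel y b z)); last ring.
  apply: le_trans (ler_normB _ _) _.
  have -> : 2 * C * a ^+ n.+1 * `|x - y| =
     C * a ^+ n.+1 * `|x - y| + C * a ^+ n.+1 * `|x - y| by ring.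
  apply: lerD; first exact: HC (ltW a0).
  apply: le_trans (HC _ _ _ _ (ltW b0)) _.
  by rewrite ler_wpM2r// ler_wpM2l// lerXn2r ?nnegrE ?(ltW a0) ?(ltW b0).
have := key_lapapprox _ rO mw aw wM.
have -> : \int[mu]_(x in Omega) (g x * w x) =
   (smear a x - smear a y) - (smear b x - smear b y).
  rewrite /smear -!RintegralB//; try (by apply: intble_kernel; exact: ltW).
  - by apply: eq_Rintegral => z _; rewrite /w; ring.
  - by apply: intbleB => //; apply: intble_kernel; exact: ltW.
  - by apply: intbleB => //; apply: intble_kernel; exact: ltW.
move=> h; apply: le_trans (h _) _; first by rewrite mulr_gt0.
rewrite le_eqVlt; apply/orP; left; apply/eqP.
have -> : 2 * (4 * r) = 8 * r by ring.
rewrite exprMn exprSr.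
have -> : 2 * C * (a ^+ n * a) * `|x - y| * (8 ^+ n * r ^+ n) =
   2 * C * 8 ^+ n * (`|x - y| * a) * (a ^+ n * r ^+ n) by ring.
by rewrite -exprMn mulVf ?expr1n ?mulr1// gt_eqF.
Qed.

Lemma smear_le (l : R) (y : V) : 0 <= l -> `|smear l y| <= I * (2 * l ^+ n).
Proof. by move=> l0; apply: Rint_gM_le (mkernel y l) (fun x => kernel_norm_le y x l0). Qed.

Context (delta : R) (delta0 : 0 < delta).

Lemma smear_osc : exists2 C : R, 0 <= C & forall (x y : V) (r : R), 0 < r -> r <= delta / 4 ->
  ball x delta `<=` Omega -> `|x - y| <= r -> `|smear r^-1 x - smear r^-1 y| <= C.
Proof.
have [K K0 HK] := smear_lip1.
pose B := 2 * (I * (2 * (8 / delta) ^+ n)).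
have B0 : 0 <= B by rewrite !mulr_ge0// exprn_ge0// divr_ge0// ltW.
exists (2 * K + B); first by rewrite addr_ge0// mulr_ge0.
move=> x y r r0 r4 xO xyr.
have big t : 0 < t -> delta / 8 <= t -> `|smear t^-1 x - smear t^-1 y| <= B.
  move=> t0 dt; apply: le_trans (ler_normB _ _) _.
  have h z : `|smear t^-1 z| <= I * (2 * (8 / delta) ^+ n).
    apply: le_trans (smear_le z _) _; first by rewrite invr_ge0 ltW.
    rewrite !ler_wpM2l// lerXn2r ?nnegrE ?invr_ge0 ?(ltW t0)// ?divr_ge0 ?(ltW delta0)//.
    by rewrite -[8 / delta]invrK lef_pV2 ?posrE ?invr_gt0 ?divr_gt0// invf_div.
  by rewrite /B mulr_natl mulr2n; exact: lerD.
(* J bounds the number of doublings that bring the scale t up to delta / 8. *)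
suff H J t : `|x - y| <= t -> 0 < t -> t <= delta / 4 -> delta / 8 <= 2 ^+ J * t ->
    `|smear t^-1 x - smear t^-1 y| <= 2 * K * (`|x - y| / t) + B.
  pose J := Num.truncn (delta / 8 / r).
  have hJ : delta / 8 <= 2 ^+ J.+1 * r.
    rewrite -ler_pdivrMr//; apply: le_trans (ltW (truncnS_gt _)) _.
    by rewrite -natrX ler_nat ltnW// ltn_expl.
  apply: le_trans (H _ _ xyr r0 r4 hJ) _; rewrite lerD2r -[leRHS]mulr1.
  by rewrite ler_wpM2l ?mulr_ge0// ler_pdivrMr// mul1r.
(* Doubling the scale costs 2 K |x - y| / t - 2 K |x - y| / (2 t), a telescoping sum. *)
elim: J t => [|J IH] t xyt t0 t4 tJ.
  rewrite mul1r in tJ; apply: le_trans (big t t0 tJ) _.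
  by rewrite lerDr !mulr_ge0// invr_ge0 ltW.
have [t8|t8] := leP (delta / 8) t.
  by apply: le_trans (big t t0 t8) _; rewrite lerDr !mulr_ge0// invr_ge0 ltW.
have h1 : `|smear (2 * t)^-1 x - smear (2 * t)^-1 y| <= 2 * K * (`|x - y| / (2 * t)) + B.
  by apply: IH; [lra|lra|lra|rewrite mulrA -exprSr].
have h2 := HK x y t t0 _ xyt.
have tO : ball x (4 * t) `<=` Omega.
  apply: subset_trans xO; apply: le_ball; lra.
have := h2 tO; set u := smear t^-1 x - _; set v := smear (2 * t)^-1 x - _ => h3.
have -> : u = (u - v) + v by rewrite subrK.
apply: le_trans (ler_normD _ _) _.
apply: le_trans (lerD h3 h1) _; rewrite addrA lerD2r.
rewrite le_eqVlt; apply/orP; left; apply/eqP; field.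
exact: lt0r_neq0.
Qed.

Lemma mean_oscillation : exists2 C : R, 0 <= C & forall (x : V) (r : R), 0 < r ->
  r <= delta / 4 -> ball x delta `<=` Omega -> exists c : R,
  \int[mu]_(y in ball x r) `|g y - c| <= C * r ^+ n.
Proof.
have [A A0 HA] := smear_osc.
have m0 := @kernel_mass_gt0 R n; set m := kernel_mass in m0.
(* First term: the sup norm of the fine sum minus the coarse sum, times the volume (8 r)^n. Second
   term: the oscillation A times the total weight (2 r)^n / m. A factor r^n is removed from both. *)
pose B : R := 8 ^+ n * (1 + 2 * 2 ^+ n / m) + A * 2 ^+ n / m.
have B0 : 0 <= B.
  rewrite addr_ge0// ?divr_ge0 ?mulr_ge0 ?exprn_ge0 ?(ltW m0)//.
  by rewrite addr_ge0// divr_ge0 ?mulr_ge0 ?exprn_ge0 ?(ltW m0).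
exists (2 * B); first by rewrite mulr_ge0.
move=> x r r0 r4 xO; exists (smear r^-1 x / m).
have ri0 : 0 < r^-1 by rewrite invr_gt0.
have rO : ball x (4 * r) `<=` Omega by apply: subset_trans xO; apply: le_ball; lra.
set U := ball x r; have mU : measurable U := measurable_ball_rV x r.
have UO : U `<=` Omega by apply: subset_trans rO; apply: le_ball; lra.
have IU : mu.-integrable U (EFin \o g) by exact: intbleS Ig.
have Ufin : (mu U < +oo)%E := ball_lty x r.
have Icst c : mu.-integrable U (EFin \o (fun=> c : R)).
  exact: (@intble_bounded _ _ _ _ _ _ `|c|).
rewrite -mulrA; apply: Rint_normr_le_test => //; first exact: intbleB.
move=> psi epsi tpsi psi01.
have psi1 z : `|psi z| <= 1 by have := psi01 z; rewrite ler_norml; lra.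
have mpsi := test_function_measurable tpsi.
have mpsiU : measurable_fun U psi by exact: measurable_funS mpsi.
have Ipsi : mu.-integrable U (EFin \o psi) by exact: (@intble_bounded _ _ _ _ _ _ 1).
have Npsi : \int[mu]_(y in U) `|psi y| <= (2 * r) ^+ n.
  apply: (@le_trans _ _ (\int[mu]_(y in U) 1)).
    by apply: le_Rintegral => //; exact: integrable_norm.
  by rewrite Rintegral_cst// mul1r fine_ball.
set W := (2 * r) ^+ n in Npsi.
have W0 : 0 <= W by rewrite exprn_ge0// mulr_ge0// ltW.
apply/ler_addgt0Pr => e0 e00.
pose X : R := (2 * (4 * r)) ^+ n.
have X0 : 0 <= X by rewrite exprn_ge0// !mulr_ge0// ltW.
(* The error e enters as I e when psi is replaced by its fine sum and as e X in the sup bound of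
   w. *)
pose e := e0 / (I + X + 1).
have e_gt0 : 0 < e by rewrite divr_gt0// ltr_wpDl// addr_ge0.
have ee0 : e * (I + X) <= e0.
  rewrite -[leRHS](@divfK _ (I + X + 1)) ?gt_eqF ?ltr_wpDl ?addr_ge0//.
  by rewrite ler_wpM2l ?lerDl// ltW.
have [l [s [lr sU sn si sk]]] := approx_kernel_sum epsi tpsi e_gt0 ri0.
have l0 : 0 < l by exact: lt_le_trans lr.
rewrite -/m -/U in sn si.
pose Wk t z := \sum_(p <- s) p.1 * kernel p.2 t z.
have mWk t : measurable_fun setT (Wk t).
  by apply: elem_measurable => //; apply: elem_sum => p _;
    apply: elemM; [exact: elem_cst|exact: elem_kernel].
have S0 : 0 <= \sum_(p <- s) `|p.1| by exact: sumr_ge0.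
have Sm : \sum_(p <- s) `|p.1| <= W / m.
  by rewrite ler_pdivlMr// mulrC; exact: le_trans Npsi.
have Wr z : `|Wk r^-1 z| <= 2 * 2 ^+ n / m.
  apply: (@le_trans _ _ (\sum_(p <- s) `|p.1| * (2 * r^-1 ^+ n))).
    apply: le_trans (ler_norm_sum _ _ _) _; apply: ler_sum => p _.
    by rewrite normrM ler_wpM2l// kernel_norm_le// ltW.
  rewrite -mulr_suml; apply: (@le_trans _ _ (W / m * (2 * r^-1 ^+ n))).
    by rewrite ler_wpM2r// mulr_ge0// exprn_ge0// ltW.
  rewrite /W exprMn [leLHS](_ : _ = 2 * 2 ^+ n / m * (r ^+ n * r^-1 ^+ n)); last by ring.
  by rewrite -exprMn mulfV ?expr1n ?mulr1// gt_eqF.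
have Wl z : `|Wk l z| <= 1 + e.
  have := ler_normD (Wk l z - psi z) (psi z); rewrite subrK => h.
  by apply: le_trans h _; rewrite addrC; apply: lerD => //; exact: sk.
pose w z := Wk l z + (-1) * Wk r^-1 z.
have mw : measurable_fun setT w by apply: measurable_funD => //; exact: measurable_funM.
have wM z : `|w z| <= 1 + 2 * 2 ^+ n / m + e.
  rewrite /w mulN1r; apply: le_trans (ler_normB _ _) _.
  by have := Wl z; have := Wr z; lra.
have aw : lapapprox (ball x (4 * r)) w.
  (* Centers are known to lie in the ball only for members of s; the conditional gives a summand
     that is admissible for every p. *)
  rewrite (_ : w = fun z => \sum_(p <- s) (if p \in s then
      p.1 * (kernel p.2 l z - kernel p.2 r^-1 z) else 0)); last first.
    apply/funext => z; rewrite -big_mkcond -big_seq /w /Wk mulN1r -sumrB.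
    by apply: eq_bigr => p _; rewrite mulrBr.
  apply: (@lapapprox_sum _ _ _ _ s (fun p z => if p \in s then
     p.1 * (kernel p.2 l z - kernel p.2 r^-1 z) else 0)) => p.
  have [ps|_] := boolP (p \in s); last exact: lapapprox0.
  apply: lapapproxZ; apply: lapapprox_kernelB => // z /(sqdist_norm ri0).
  rewrite invrK => zp; have /rV_ballE xp := sU p ps.
  apply/rV_ballE; rewrite -(subrK p.2 x) -addrA.
  apply: le_lt_trans (ler_normD _ _) _; rewrite [`|p.2 - z|]distrC.
  have := normr_ge0 (x - p.2); lra.
have T2 : `|\int[mu]_(y in Omega) (g y * w y)| <= (1 + 2 * 2 ^+ n / m + e) * X.
  by apply: (@key_lapapprox x (4 * r)) => //; rewrite mulr_gt0.
have T1 : `|\int[mu]_(y in Omega) (g y * (psi y - Wk l y))| <= I * e.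
  apply: Rint_gM_le => [|z]; first exact: measurable_funB.
  by rewrite distrC; exact: sk.
have IW t : 0 < t -> mu.-integrable Omega (EFin \o (fun y => g y * Wk t y)).
  move=> t0; rewrite (_ : (fun y => _) = fun y => \sum_(p <- s) p.1 * (g y * kernel p.2 t y)).
    by apply: intble_sum => // p; apply: intbleZ => //; apply: intble_kernel; exact: ltW.
  by apply/funext => y; rewrite mulr_sumr; apply: eq_bigr => p _; rewrite mulrCA.
have IWE t : 0 < t -> \int[mu]_(y in Omega) (g y * Wk t y) = \sum_(p <- s) p.1 * smear t p.2.
  move=> t0; rewrite (_ : (fun y => _) = fun y => \sum_(p <- s) p.1 * (g y * kernel p.2 t y)).
    rewrite Rint_sum//.
      by apply: eq_bigr => p _; rewrite RintegralZl//; apply: intble_kernel; exact: ltW.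
    by move=> p; apply: intbleZ => //; apply: intble_kernel; exact: ltW.
  by apply/funext => y; rewrite mulr_sumr; apply: eq_bigr => p _; rewrite mulrCA.
have T3 : `|\sum_(p <- s) p.1 * (smear r^-1 p.2 - smear r^-1 x)| <= A * (W / m).
  apply: (@le_trans _ _ (\sum_(p <- s) `|p.1| * A)).
    apply: le_trans (ler_norm_sum _ _ _) _; rewrite !big_seq; apply: ler_sum => p ps.
    rewrite normrM ler_wpM2l// distrC; apply: HA => //.
    by have /rV_ballE/ltW := sU p ps.
  by rewrite -mulr_suml mulrC ler_wpM2l.
have Igpsi : mu.-integrable Omega (EFin \o (fun y => g y * psi y)) by exact: intble_gM mpsi psi1.
(* Split psi as (psi - fine sum) + w + coarse sum. Since the weights sum to the integral of psi over
   m, subtracting the constant turns the coarse part into differences of [smear] between the centers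
   and x. *)
have -> : \int[mu]_(y in U) ((g y - smear r^-1 x / m) * psi y) =
   \int[mu]_(y in Omega) (g y * (psi y - Wk l y)) + \int[mu]_(y in Omega) (g y * w y)
   + \sum_(p <- s) p.1 * (smear r^-1 p.2 - smear r^-1 x).
  have -> : \int[mu]_(y in U) ((g y - smear r^-1 x / m) * psi y) =
    \int[mu]_(y in Omega) (g y * psi y) - smear r^-1 x / m * \int[mu]_(y in U) psi y.
    have [_ [L [_ LU pL]]] := tpsi.
    rewrite (@Rint_sub _ _ _ mu Omega U)//; last first.
      by move=> y _ Uy; rewrite pL ?mulr0// => /LU.
    rewrite -RintegralZl// -RintegralB//; last 2 first.
      by apply: (@intbleM _ _ _ _ _ _ _ 1).
      exact: intbleZ.
    by apply: eq_Rintegral => y _; rewrite mulrBl.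
  have -> : \int[mu]_(y in Omega) (g y * (psi y - Wk l y)) =
     \int[mu]_(y in Omega) (g y * psi y) - \int[mu]_(y in Omega) (g y * Wk l y).
    by rewrite -RintegralB//; [apply: eq_Rintegral => y _; rewrite mulrBr|exact: IW].
  have -> : \int[mu]_(y in Omega) (g y * w y) =
     \int[mu]_(y in Omega) (g y * Wk l y) - \int[mu]_(y in Omega) (g y * Wk r^-1 y).
    rewrite -RintegralB//; [|exact: IW|exact: IW].
    by apply: eq_Rintegral => y _; rewrite /w mulN1r mulrBr.
  rewrite (IWE _ ri0) -si.
  have -> : \sum_(p <- s) p.1 * (smear r^-1 p.2 - smear r^-1 x) =
      \sum_(p <- s) p.1 * smear r^-1 p.2 - (\sum_(p <- s) p.1) * smear r^-1 x.
    by rewrite mulr_suml -sumrB; apply: eq_bigr => p _; rewrite mulrBr.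
  field; exact: lt0r_neq0.
apply: le_trans (ler_normD _ _) _.
apply: le_trans (lerD (ler_normD _ _) T3) _.
apply: le_trans (lerD (lerD T1 T2) (lexx _)) _.
have -> : B * r ^+ n = (1 + 2 * 2 ^+ n / m) * X + A * (W / m).
  rewrite /B /X /W (_ : 2 * (4 * r) = 8 * r); last by ring.
  by rewrite !exprMn; field; exact: lt0r_neq0.
lra.
Qed.

End oscillation.

(** * Euclidean balls compared with sup-norm balls *)

Section euclidean_balls.
Context {R : realType} {n : nat}.
Local Notation V := ('rV[R]_n).
Local Notation mu := (@lebesgue_rV R n).

(** A Lebesgue number argument in filter form: near each point of K half of its radius works, and
    compactness makes the choice uniform. *)
Lemma compact_uniform_ball (K Omega : set V) : compact K -> open Omega ->
  K `<=` Omega -> exists2 d : R, 0 < d & forall x, K x -> ball x d `<=` Omega.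
Proof.
move=> /compact_near_coveringP cK oO KO.
have H : \forall d \near (0 : R)^'+, K `<=` (fun x => ball x d `<=` Omega).
  apply: (cK _ (0 : R)^'+ (fun d x => ball x d `<=` Omega)) => x /KO Ox.
  have /nbhs_ballP[e /= e0 eO] : nbhs x Omega by exact: open_nbhs_nbhs.
  exists (ball x (e / 2), [set d | d < e / 2]) => /=.
    split; first by apply: nbhsx_ballx; rewrite divr_gt0.
    by apply: nbhs_right_lt; rewrite divr_gt0.
  move=> [y d] /= [/rV_ballE xy de] z /rV_ballE yz; apply: eO; apply/rV_ballE.
  rewrite -(subrK y x) -addrA; apply: le_lt_trans (ler_normD _ _) _; lra.
have [d [/= Hd d0]] : exists d : R, (K `<=` (fun x => ball x d `<=` Omega)) /\ 0 < d.
  near (0 : R)^'+ => d; exists d; split; first by near: d.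
  by near: d; exact: nbhs_right_gt.
by exists d.
Unshelve. all: end_near. Qed.

Lemma eballE (x : V) (r : R) y : 0 < r -> eball x r y <-> sqdist x y < r ^+ 2.
Proof.
move=> r0; rewrite /eball/= (_ : \sum_(i < n) _ = sqdist x y); last first.
  by apply: eq_bigr => i _; rewrite expr2.
rewrite -[X in Num.sqrt _ < X](ger0_norm (ltW r0)) -sqrtr_sqr ltr_sqrt//.
by rewrite exprn_gt0.
Qed.

Lemma measurable_eball (x : V) (r : R) : 0 < r -> measurable (eball x r).
Proof.
move=> r0; have ms : measurable_fun setT (sqdist x : V -> R).
  exact: elem_measurable (elem_sqdist x).
rewrite (_ : eball x r = setT `&` (sqdist x) @^-1` `]-oo, r ^+ 2[%classic).
  by apply: ms => //; exact: measurable_itv.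
by apply/seteqP; split => y; rewrite setTI /= in_itv/= eballE.
Qed.

Lemma eball_center (x : V) (r : R) : 0 < r -> eball x r x.
Proof.
move=> r0; rewrite eballE// /sqdist big1 ?exprn_gt0// => i _.
by rewrite subrr mulr0.
Qed.

Lemma eball_sub_ball (x : V) (r : R) : 0 < r -> eball x r `<=` ball x r.
Proof.
move=> r0 y; rewrite eballE// => h; apply/rV_ballP; split => // i.
suff : `|x ord0 i - y ord0 i| ^+ 2 < r ^+ 2 by rewrite ltr_pXn2r ?nnegrE ?(ltW r0).
rewrite distrC real_normK ?num_real//.
exact: le_lt_trans (sqdist_coor _ _ _) h.
Qed.

(** The factor n + 1 is cruder than the square root of n, but it avoids roots and gives a strict
    inequality, n d^2 < ((n + 1) d)^2. *)
Lemma ball_sub_eball (x : V) (r : R) : 0 < r -> ball x (r / n.+1%:R) `<=` eball x r.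
Proof.
move=> r0 y /rV_ballP[d0 h]; rewrite eballE//; set d := r / n.+1%:R in d0 h.
have rd : r = n.+1%:R * d by rewrite mulrC divfK// pnatr_eq0.
clearbody d.
apply: (@le_lt_trans _ _ (n%:R * d ^+ 2)).
  rewrite mulr_natl -[X in _ *+ X](card_ord n) -sumr_const; apply: ler_sum => i _.
  rewrite -expr2 -real_normK ?num_real// lerXn2r ?nnegrE ?(ltW d0)//.
  by rewrite distrC ltW.
rewrite rd exprMn ltr_pM2r ?exprn_gt0// -natrX ltr_nat expnS expn1.
by rewrite mulSn leq_addr.
Qed.

Lemma eball_lty (x : V) (r : R) : 0 < r -> (mu (eball x r) < +oo)%E.
Proof.
move=> r0; apply: le_lt_trans (ball_lty x r); apply: le_measure.
- by rewrite inE; exact: measurable_eball.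
- by rewrite inE; exact: measurable_ball_rV.
- exact: eball_sub_ball.
Qed.

Lemma fine_eball_ge (x : V) (r : R) : 0 < r ->
  (2 * (r / n.+1%:R)) ^+ n <= fine (mu (eball x r)).
Proof.
move=> r0; rewrite -(@fine_ball _ _ x) ?divr_gt0//; apply: fine_le.
- by rewrite ge0_fin_numE//; exact: ball_lty.
- by rewrite ge0_fin_numE//; exact: eball_lty.
- apply: le_measure; last exact: ball_sub_eball.
  + by rewrite inE; exact: measurable_ball_rV.
  + by rewrite inE; exact: measurable_eball.
Qed.

(** The average differs from c by at most the mean of |f - c|, so passing from c to the average at
    most doubles the integral. *)
Lemma oscillation_average (f : V -> R) (x : V) (r c : R) : 0 < r ->
  mu.-integrable (eball x r) (EFin \o f) ->
  \int[mu]_(y in eball x r) `|f y - average f (eball x r)| <=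
    2 * \int[mu]_(y in eball x r) `|f y - c|.
Proof.
move=> r0 If; set B := eball x r; have mB : measurable B := measurable_eball x r0.
have Bfin : (mu B < +oo)%E := eball_lty x r0.
have Icst (k : R) : mu.-integrable B (EFin \o (fun=> k)).
  exact: (@intble_bounded _ _ _ _ _ _ `|k|).
have W0 : 0 < fine (mu B).
  by apply: lt_le_trans (fine_eball_ge x r0); rewrite exprn_gt0// mulr_gt0// divr_gt0.
set a := average f B.
have aE : a - c = (fine (mu B))^-1 * \int[mu]_(y in B) (f y - c).
  by rewrite RintegralB// Rintegral_cst// mulrBr [c * _]mulrC mulKf// gt_eqF.
have ac : `|a - c| * fine (mu B) <= \int[mu]_(y in B) `|f y - c|.
  rewrite aE normrM [`|_^-1|]ger0_norm ?invr_ge0 ?(ltW W0)// mulrC mulrA mulfV ?gt_eqF// mul1r.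
  by apply: le_normr_Rintegral => //; exact: intbleB.
have Iac : mu.-integrable B (EFin \o (fun y => `|f y - c|)).
  by apply: integrable_norm; exact: intbleB.
apply: (@le_trans _ _ (\int[mu]_(y in B) (`|f y - c| + `|a - c|))).
  apply: le_Rintegral => //.
  - by apply: integrable_norm; exact: intbleB.
  - exact: intbleD.
  - move=> y _; rewrite (_ : f y - a = (f y - c) - (a - c)); last by ring.
    exact: ler_normB.
rewrite RintegralD// Rintegral_cst//; lra.
Qed.

End euclidean_balls.

(** * The local BMO estimate *)

Theorem theorem1p1 (R : realType) (n : nat) (n_gt0 : (0 < n)%N)
    (Omega : set 'rV[R]_n) (u0 u : 'rV[R]_n -> R) :
  smooth_bounded_domain Omega ->
  sobolevW2 Omega 2 u0 ->
  minimizer Omega u0 u ->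
  BMO_loc Omega (laplacian Omega u).
Proof.
move=> [_ oO _ bO _] _ umin; have [[Wu _] _] := umin.
have Lg := laplacian_L2 oO bO Wu.
have mO := open_measurable_rV oO.
have Ig := L2_L1 oO bO Lg.
have key := key_inequality oO bO umin.
set g := laplacian Omega u in Lg Ig key *.
have [mg _] := Lg.
have lg D : open D -> D `<=` Omega -> L1loc D g.
  move=> oD DO; have mD := open_measurable_rV oD.
  split; first exact: measurable_funS mg.
  move=> K cK KD; apply: (@intbleS _ _ _ _ Omega) => //.
    exact: compact_measurable_rV.
  exact: subset_trans DO.
split; first exact: lg.
move=> D oD cD DO; have DsubO : D `<=` Omega by apply: subset_trans DO; exact: subset_closure.
split; first exact: lg.
have [d d0 dO] := compact_uniform_ball cD oO DO.
have [C C0 HC] := mean_oscillation oO Ig key d0.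
set I := \int[lebesgue_rV n]_(y in Omega) `|g y|.
have I0 : 0 <= I by exact: Rintegral_ge0.
(* A Euclidean ball of radius r has measure at least q r^n, and at least q s once r > d / 4. The two
   summands of M below serve small and large radii. *)
pose q : R := (2 / n.+1%:R) ^+ n.
have q0 : 0 < q by rewrite exprn_gt0// divr_gt0.
pose s : R := (d / 4) ^+ n.
have s0 : 0 < s by rewrite exprn_gt0// divr_gt0.
pose M := 2 * (C / q) + 2 * (I / (q * s)).
exists M => x r r0 rD.
have Dx : D x by apply: rD; exact: eball_center.
set B := eball x r; have mB : measurable B := measurable_eball x r0.
have BO : B `<=` Omega by exact: subset_trans DsubO.
have IB : (lebesgue_rV n).-integrable B (EFin \o g) by apply: intbleS Ig.
have Bfin : (lebesgue_rV n B < +oo)%E := eball_lty x r0.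
have Icst (k : R) : (lebesgue_rV n).-integrable B (EFin \o (fun=> k)).
  exact: (@intble_bounded _ _ _ _ _ _ `|k|).
have W : q * r ^+ n <= fine (lebesgue_rV n B).
  apply: le_trans (fine_eball_ge x r0); rewrite -exprMn.
  by rewrite (_ : 2 / n.+1%:R * r = 2 * (r / n.+1%:R)) ?lexx//; ring.
have W0 : 0 <= fine (lebesgue_rV n B) by exact: fine_ge0.
rewrite -(fineK (x := lebesgue_rV n B)) ?ge0_fin_numE// -EFinM -Rint_EFin//; last first.
  by apply: integrable_norm; exact: intbleB.
rewrite lee_fin.
have [r4|r4] := leP r (d / 4).
  have xO : ball x d `<=` Omega by apply: dO; exact: subset_closure.
  have [c Hc] := HC x r r0 r4 xO.
  apply: le_trans (oscillation_average c r0 IB) _.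
  have h : \int[lebesgue_rV n]_(y in B) `|g y - c| <= C * r ^+ n.
    apply: le_trans Hc; apply: le_Rint_set => //.
    - exact: measurable_ball_rV.
    - exact: eball_sub_ball.
    - apply: integrable_norm; apply: intbleB; first exact: measurable_ball_rV.
        apply: (intbleS _ _ _ Ig) => //; first exact: measurable_ball_rV.
        by apply: subset_trans xO; apply: le_ball; lra.
      apply: (@intble_bounded _ _ _ _ _ _ `|c|) => //; first exact: measurable_ball_rV.
      exact: ball_lty.
  apply: (@le_trans _ _ (2 * (C / q) * fine (lebesgue_rV n B))).
    rewrite -mulrA ler_wpM2l//; apply: le_trans h _.
    by rewrite -mulrA ler_wpM2l// ler_pdivlMl.
  by rewrite ler_wpM2r// lerDl mulr_ge0// divr_ge0// mulr_ge0// ltW.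
(* For large radii the measure of the ball is bounded below, so c = 0 and the integral of |g| over
   Omega suffice. *)
apply: le_trans (oscillation_average 0 r0 IB) _.
have h : \int[lebesgue_rV n]_(y in B) `|g y - 0| <= I.
  under eq_Rintegral do rewrite subr0.
  by apply: le_Rint_set => //; exact: integrable_norm.
apply: (@le_trans _ _ (2 * (I / (q * s)) * fine (lebesgue_rV n B))).
  rewrite -mulrA ler_wpM2l//; apply: le_trans h _.
  rewrite mulrAC ler_pdivlMr ?mulr_gt0// ler_wpM2l//.
  apply: le_trans W; rewrite ler_wpM2l ?(ltW q0)//.
  by rewrite lerXn2r ?nnegrE ?(ltW r0) ?(ltW r4)// divr_ge0// ltW.
by rewrite ler_wpM2r// lerDr mulr_ge0// divr_ge0// ltW.
Qed.
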